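(* Let $M$ be an $n$-dimensional closed manifold equipped with a Riemannian metric and let $H:T^*M\times\mathbb{R}\to\mathbb{R}$, $(x,p,u)\mapsto H(x,p,u)$, be continuous and satisfy: (i) $H$ is convex in $p\in T_x^*M$ for any $(x,u)\in M\times\mathbb{R}$; (ii) $\lim_{|p|_x\to+\infty}H(x,p,u)/|p|_x=+\infty$ for any $(x,u)\in M\times\mathbb{R}$; (iii) $H(x,p,u)$ is non-decreasing in $u$ for any $(x,p)\in T^*M$. For $\theta\in\mathbb{R}$ let $c(\theta)$ be the ergodic constant of $H(\cdot,\cdot,\theta)$. Then: 1) the function $c:\mathbb{R}\to\mathbb{R}$ is continuous and non-decreasing; 2) denoting $\mathfrak{C}:=\{c(a)\mid a\in\mathbb{R}\}$, for any $c\in\mathfrak{C}$ the associated equation $H(x,d_xu,u)=c$, $x\in M$, admits a viscosity solution $u\in C(M,\mathbb{R})$.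
   Context: $|\cdot|_x$ denotes the norm at $x\in M$ induced by the Riemannian metric. For $\theta\in\mathbb{R}$ the ergodic constant is the unique real number defined by $$c(\theta):=\inf\{c\in\mathbb{R}:\ H(x,d_x\omega,\theta)\le c \text{ is solvable in the sense of viscosity on } M\},$$ i.e. the infimum of those $c$ for which there is a viscosity subsolution $\omega$ of $H(x,d_x\omega,\theta)=c$ on $M$.
   Formalization: The closed manifold M is taken to be connected (and nonempty); on a disconnected M part 2 fails, e.g. two disjoint circles with H = |p|² on one and |p|² − 1 on the other, where c = 0 but |u'|² = 1 has no viscosity solution. *)

(* Defs.v *)
From HB Require Import structures.
From mathcomp Require Import all_boot all_order all_algebra.
From mathcomp Require Import all_classical all_reals all_analysis.
Import Order.TTheory GRing.Theory Num.Theory.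
Import numFieldNormedType.Exports.

Set Implicit Arguments.
Unset Strict Implicit.
Unset Printing Implicit Defensive.

Local Open Scope classical_set_scope.
Local Open Scope ring_scope.

(* C^k regularity on an open set D, via iterated directional derivatives
   (for finite-dimensional U: all partial derivatives of order at most k exist
   and are continuous on D). *)
Fixpoint Ck_on (R : realType) (U V : normedModType R) (k : nat) (D : set U)
    (f : U -> V) : Prop :=
  match k with
  | 0 => {in D, continuous f}
  | k'.+1 => [/\ {in D, continuous f},
                 forall x v, D x -> derivable f x v &
                 forall v, Ck_on k' D (fun x => 'D_v f x)]
  end.

Definition smooth_on (R : realType) (U V : normedModType R) (D : set U)
    (f : U -> V) : Prop := forall k, Ck_on k D f.

(* A smooth atlas of dimension n on M.  [chart_inv i] is only meaningful on
   [chart i @` chart_dom i].  [chart_at x] is a preferred chart around x: it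
   serves to identify T_xM with 'rV_n and T_x^*M with 'cV_n, the pairing of a
   vector v and a covector p being (v *m p) 0 0.  No compatibility between the
   preferred charts of different points is required. *)
Record smooth_atlas (R : realType) (n : nat) (M : topologicalType) :=
  SmoothAtlas {
    chart_index : Type;
    chart_dom : chart_index -> set M;
    chart : chart_index -> M -> 'rV[R]_n;
    chart_inv : chart_index -> 'rV[R]_n -> M;
    chart_at : M -> chart_index;
    chart_dom_open : forall i, open (chart_dom i);
    chart_img_open : forall i, open (chart i @` chart_dom i);
    chartK : forall i, {in chart_dom i, cancel (chart i) (chart_inv i)};
    chart_continuous : forall i, {in chart_dom i, continuous (chart i)};
    chart_inv_continuous :
      forall i, {in chart i @` chart_dom i, continuous (chart_inv i)};
    chart_atP : forall x, chart_dom (chart_at x) x;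
    transition_smooth : forall i j,
      smooth_on (chart i @` (chart_dom i `&` chart_dom j))
                (chart j \o chart_inv i)
  }.

(* Second countability is automatic for a compact locally Euclidean space. *)
Definition closed_connected (M : topologicalType) : Prop :=
  [/\ hausdorff_space M, compact [set: M], connected [set: M] &
      [set: M] !=set0].

Section Manifold.
Context (R : realType) (n : nat) (M : topologicalType)
  (A : smooth_atlas R n M).

(* With the row convention of ['J], a tangent vector with coordinates v in
   chart i has coordinates [v *m transition_jac i j x] in chart j.  Dually, a
   covector with coordinates p in chart j has coordinates
   [transition_jac i j x *m p] in chart i. *)
Definition transition_jac (i j : chart_index A) (x : M) : 'M[R]_n :=
  'J (chart j \o chart_inv i) (chart i x).

(* The element of T_x^*M whose coordinates in chart i are q. *)
Definition covector_of_chart (i : chart_index A) (x : M) (q : 'cV[R]_n) :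
    'cV[R]_n := transition_jac (chart_at A x) i x *m q.

Definition C1_on (U : set M) (phi : M -> R) : Prop :=
  forall i : chart_index A,
    Ck_on 1 (chart i @` (chart_dom i `&` U)) (phi \o chart_inv i : _ -> R^o).

(* d_x phi in T_x^*M. *)
Definition cotangent_diff (phi : M -> R) (x : M) : 'cV[R]_n :=
  \col_k 'D_(delta_mx 0 k : 'rV[R]_n)
    (phi \o chart_inv (chart_at A x) : _ -> R^o) (chart (chart_at A x) x).

(* [metric x] is the Gram matrix of the inner product of T_xM; smoothness is
   that of the Gram matrix in each chart. *)
Record riemannian_metric := RiemannianMetric {
  metric : M -> 'M[R]_n;
  metric_sym : forall x, (metric x)^T = metric x;
  metric_pos : forall x (v : 'rV[R]_n),
    v != 0 -> 0 < (v *m metric x *m v^T) 0 0;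
  metric_smooth : forall i : chart_index A,
    smooth_on (chart i @` chart_dom i)
      (fun y => let x := chart_inv i y in
                let J := transition_jac i (chart_at A x) x in
                J *m metric x *m J^T)
}.

(* |p|_x: the dual norm on T_x^*M, whose Gram matrix is the inverse one. *)
Definition covector_norm (g : riemannian_metric) (x : M) (p : 'cV[R]_n) : R :=
  Num.sqrt ((p^T *m invmx (metric g x) *m p) 0 0).

(* [H x p u] stands for H(x,p,u) with p in T_x^*M. *)
Implicit Type H : M -> 'cV[R]_n -> R -> R.

(* Continuity on T^*M x R, whose topology is the one making the bundle charts
   (chart domain) x 'cV_n -> T^*M open embeddings. *)
Definition hamiltonian_continuous H : Prop :=
  forall i : chart_index A,
    {in [set z : M * 'cV[R]_n * R | chart_dom i z.1.1],
      continuous (fun z : M * 'cV[R]_n * R =>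
        H z.1.1 (covector_of_chart i z.1.1 z.1.2) z.2)}.

Definition hamiltonian_convex H : Prop :=
  forall x u (p q : 'cV[R]_n) (t : R), 0 <= t <= 1 ->
    H x (t *: p + (1 - t) *: q) u <= t * H x p u + (1 - t) * H x q u.

Definition hamiltonian_superlinear (g : riemannian_metric) H : Prop :=
  forall x u (K : R), exists B : R, forall p : 'cV[R]_n,
    B < covector_norm g x p -> K < H x p u / covector_norm g x p.

Definition hamiltonian_nondecreasing H : Prop :=
  forall x p, {homo H x p : u v / u <= v}.

(* Viscosity sub- and supersolutions of H(x, d_x w, w(x)) = c. *)
Definition viscosity_subsolution H (c : R) (w : M -> R) : Prop :=
  continuous w /\
  forall (x : M) (U : set M) (phi : M -> R),
    open U -> U x -> C1_on U phi ->
    (\forall y \near x, w y - phi y <= w x - phi x) ->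
    H x (cotangent_diff phi x) (w x) <= c.

Definition viscosity_supersolution H (c : R) (w : M -> R) : Prop :=
  continuous w /\
  forall (x : M) (U : set M) (phi : M -> R),
    open U -> U x -> C1_on U phi ->
    (\forall y \near x, w x - phi x <= w y - phi y) ->
    c <= H x (cotangent_diff phi x) (w x).

Definition viscosity_solution H (c : R) (w : M -> R) : Prop :=
  viscosity_subsolution H c w /\ viscosity_supersolution H c w.

(* c(theta).  [inf] is a default value on sets that are empty or unbounded
   below; this does not occur for the Hamiltonians considered, on a nonempty
   compact M. *)
Definition ergodic_constant H (theta : R) : R :=
  inf [set c : R | exists w : M -> R,
         viscosity_subsolution (fun x p _ => H x p theta) c w].

End Manifold.

(* Main.v *)
From HB Require Import structures.
Require Import Defs.
From mathcomp Require Import all_boot all_order all_algebra.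
From mathcomp Require Import all_classical all_reals all_analysis.
From mathcomp Require Import ring lra.
Import Order.TTheory GRing.Theory Num.Theory.
Import numFieldNormedType.Exports.

Set Implicit Arguments.
Unset Strict Implicit.
Unset Printing Implicit Defensive.

Local Open Scope classical_set_scope.
Local Open Scope ring_scope.

(** Write E(a) for the set of levels c at which H(x, d_x w, a) <= c has a
    viscosity subsolution, so that c(a) = inf E(a).

    Convexity and superlinearity bound the covectors of a sublevel of
    H(., ., a) locally uniformly in the base point
    ([superlinear_locally_coercive]).  Hence the test covectors of all
    subsolutions of a given level stay in a compact set.  Comparison with
    steep cones in charts then makes the subsolutions of that level
    equicontinuous ([supergrad_bound_lipschitz],
    [subsolutions_equicontinuous]), and on a compact connected manifold their
    oscillation is bounded by one constant ([subsolutions_bounded_osc]).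

    For part 1, monotonicity of H gives that E decreases with a.  On the
    compact set of relevant covectors H is uniformly continuous in u, so a
    subsolution for the parameter a is one for every nearby b, at a level
    raised by a small amount ([hamiltonian_uniform_in_u],
    [ergodic_le_of_levels]).

    For part 2, Perron's method ([perron]) produces a solution between any
    ordered subsolution and supersolution: the supremum of the subsolutions in
    between is continuous by equicontinuity, is a subsolution by stability, and
    is a supersolution because it could otherwise be raised locally
    ([subsolution_bump]).  Put c = c(a).  The method is first applied to the
    discounted equation

      H(x, d_x v, a) + eps (v - a) = c,

    between an almost critical subsolution normalized to have maximum a - 1
    and a large constant.  Its solution is at least a - 1 somewhere by
    construction.  It is at most a somewhere, since a solution v > a would be a
    subsolution of H(x, d_x v, a) <= c - eps (min v - a), a level below the
    infimum c(a).  With the bound on oscillations, these two facts make the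
    discounted solutions bounded uniformly in eps ([discounted_solution]), and
    a uniform limit point as eps tends to 0 solves H(x, d_x v, a) = c
    ([critical_solution]).  Lowering v below the value a gives, by monotonicity
    of H in u, a subsolution of H(x, d_x u, u) = c, and raising it above a
    gives a supersolution; a second use of Perron's method ends the proof
    ([ergodic_level_solution]). *)

(** * Continuously differentiable functions on R^n *)

Section Calculus.
Context {R : realType}.

Lemma is_derive_line {V W : normedModType R} (f : V -> W) (z v : V) (t : R) :
  derivable f (z + t *: v) v ->
  is_derive t 1 (fun s : R => f (z + s *: v)) ('D_v f (z + t *: v)).
Proof.
move=> df; have E : (fun h : R => h^-1 *: (f (h *: v + (z + t *: v)) - f (z + t *: v))) =
    (fun h : R => h^-1 *: (f (z + (h *: 1 + t) *: v) - f (z + t *: v))).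
  by apply/funext => h; rewrite [h *: 1]mulr1 scalerDl addrCA.
apply: DeriveDef; last by rewrite /derive E.
by move: df; rewrite /derivable E.
Qed.

(** The derivative along v is all that is known of f near x, so homogeneity in
    the direction comes from the one-variable chain rule on the line through
    x. *)
Lemma derivable_deriveZv {V W : normedModType R} (f : V -> W) (x v : V) (c : R) :
  derivable f x v -> 'D_(c *: v) f x = c *: 'D_v f x.
Proof.
move=> df.
have df0 : derivable f (x + 0 *: v) v by rewrite scale0r addr0.
have := is_derive_line df0; set g := (fun s : R => _) => -[dg0 Dg0].
have -> : 'D_(c *: v) f x = 'D_1 (g \o ( *%R c)) 0.
  rewrite /derive.
  suff -> : (fun h : R => h^-1 *: (f (h *: (c *: v) + x) - f x)) =
    (fun h : R => h^-1 *: ((g \o *%R c) (h *: 1 + 0) - (g \o *%R c) 0)) by [].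
  apply/funext => h; rewrite /g /= addr0 mulr0 scale0r addr0 [h *: 1]mulr1.
  by rewrite scalerA (mulrC h) [x + _]addrC.
have dg : differentiable g 0 by apply/derivable1_diffP.
have dgc : differentiable g (c * 0) by rewrite mulr0.
have dc : differentiable ( *%R c) (0 : R) by [].
have dgoc : differentiable (g \o *%R c) 0 by exact: differentiable_comp.
rewrite (deriveE _ dgoc) (diff_comp dc dgc) /= diff_val /= mulr0.
by rewrite linearZ -(deriveE _ dg) Dg0 scale0r addr0.
Qed.

Lemma mean_value_line {V : normedModType R} (f : V -> R^o) (z v : V) :
  (forall t : R, 0 <= t <= 1 -> derivable f (z + t *: v) v) ->
  exists2 t : R, 0 <= t <= 1 & f (z + v) - f z = 'D_v f (z + t *: v).
Proof.
move=> df.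
have isd (t : R) : t \in `[0, 1]%R ->
    is_derive t 1 (fun s : R => f (z + s *: v)) ('D_v f (z + t *: v)).
  by rewrite in_itv /= => t01; apply: is_derive_line; exact: df.
have cg : {within `[0, 1], continuous (fun s : R => f (z + s *: v) : R)}.
  apply: derivable_within_continuous => t t01.
  by have [] := isd _ t01.
have [t t01 E] := @MVT_segment R _ (fun t => 'D_v f (z + t *: v)) _ _ ler01
  (fun t t01 => isd _ (subset_itv_oo_cc t01)) cg.
exists t; first by move: t01; rewrite in_itv.
by move: E; rewrite scale1r scale0r addr0 subr0 mulr1.
Qed.

Lemma norm_coord_le {m n} (y : 'M[R]_(m, n)) i j : `|y i j| <= `|y|.
Proof.
rewrite [leRHS]/Num.Def.normr /= mx_normrE.
exact: (le_bigmax _ (fun ij : 'I_m * 'I_n => `|y ij.1 ij.2|) (i, j)).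
Qed.

Lemma norm_le_coord {m n} (y : 'M[R]_(m, n)) (e : R) :
  0 <= e -> (forall i j, `|y i j| <= e) -> `|y| <= e.
Proof.
move=> e0 ye; rewrite [leLHS]/Num.Def.normr /= mx_normrE.
by apply: bigmax_le => // -[i j] _; exact: ye.
Qed.

Lemma cvg_sumR {T : Type} (F : set_system T) {FF : Filter F} n
    (f : 'I_n -> T -> R) (a : 'I_n -> R) :
  (forall i, f i x @[x --> F] --> a i) ->
  \sum_i f i x @[x --> F] --> \sum_i a i.
Proof.
move=> fa; apply: cvg_big => [|//]; exact: add_continuous.
Qed.

Lemma cvg_mxP {T : Type} (F : set_system T) {FF : Filter F} m n
    (f : T -> 'M[R]_(m, n)) (l : 'M[R]_(m, n)) :
  (forall i j, f x i j @[x --> F] --> l i j) -> f x @[x --> F] --> l.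
Proof.
move=> fl; apply/cvgrPdist_le => e e0.
have : \forall x \near F, forall ij : 'I_m * 'I_n, `|l ij.1 ij.2 - f x ij.1 ij.2| <= e.
  apply: filter_forall => -[i j] /=.
  by have /cvgrPdist_le := fl i j; apply.
apply: filterS => x fx; apply: norm_le_coord; first exact: ltW.
by move=> i j; rewrite !mxE; exact: (fx (i, j)).
Qed.

Lemma cvg_coord {T : Type} (F : set_system T) {FF : Filter F} m n
    (f : T -> 'M[R]_(m, n)) (a : 'M[R]_(m, n)) i j :
  f x @[x --> F] --> a -> f x i j @[x --> F] --> a i j.
Proof.
move=> /cvgrPdist_lt fa; apply/cvgrPdist_lt => e e0.
apply: filterS (fa e e0) => x; apply: le_lt_trans.
by have := norm_coord_le (a - f x) i j; rewrite !mxE.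
Qed.

Lemma cvg_mulmx {T : Type} (F : set_system T) {FF : Filter F} m n p
    (f : T -> 'M[R]_(m, n)) (g : T -> 'M[R]_(n, p))
    (a : 'M[R]_(m, n)) (b : 'M[R]_(n, p)) :
  f x @[x --> F] --> a -> g x @[x --> F] --> b ->
  f x *m g x @[x --> F] --> a *m b.
Proof.
move=> fa gb; apply: cvg_mxP => i j; rewrite mxE.
under eq_cvg do rewrite mxE.
apply: cvg_sumR => k; apply: cvgM.
  exact: cvg_coord.
exact: cvg_coord.
Qed.

Lemma differentiable_linear_remainder {V W : normedModType R} (f : V -> W)
    (df : {linear V -> W}) y :
  continuous df ->
  (forall e : R, 0 < e ->
    \forall h \near (0 : V), `|f (h + y) - f y - df h| <= e * `|h|) ->
  differentiable f y /\ 'd f y = df :> (V -> W).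
Proof.
move=> cdf fy; have main : f \o shift y = cst (f y) + df +o_ 0 id.
  apply/eqaddoP => e e0; apply: filterS (fy e e0) => h.
  by rewrite -addrA -opprD.
by split; [apply/diff_locallyP|]; rewrite (diff_unique cdf main).
Qed.

(** A column, like covectors: C1 functions satisfy
    ['D_v f y = (v *m grad f y) 0 0]. *)
Definition grad {n} (f : 'rV[R]_n -> R) (y : 'rV[R]_n) : 'cV[R]_n :=
  \col_k 'D_(delta_mx 0 k : 'rV[R]_n) (f : _ -> R^o) y.

(** Going from y to y + h along the axes, one coordinate at a time, the mean
    value theorem turns each increment into a partial derivative at a point
    near y, which continuity compares with its value at y. *)
Lemma C1_differentiable {n} (D : set 'rV[R]_n) (f : 'rV[R]_n -> R^o) y :
  open D -> Ck_on 1 D f -> D y -> 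
  differentiable f y /\ forall v, 'D_v f y = (v *m grad f y) 0 0.
Proof.
move=> oD [_ fd fc] Dy.
pose df (v : 'rV[R]_n) : R^o := (v *m grad f y) 0 0.
have dflin : linear df.
  by move=> a u v; rewrite /df mulmxDl -scalemxAl !mxE.
pose dfL : {linear 'rV[R]_n -> R^o} := HB.pack df (GRing.isLinear.Build _ _ _ _ _ dflin).
have dfE v : df v = \sum_k v 0 k * grad f y k 0 by rewrite /df mxE.
have cdf : continuous dfL.
  move=> v; rewrite (_ : (dfL : _ -> _) = fun v => \sum_k v 0 k * grad f y k 0); last first.
    by apply/funext => u; rewrite /= dfE.
  apply: (@cvg_sumR _ (nbhs v) _ n (fun k (u : 'rV[R]_n) => u 0 k * grad f y k 0)
    (fun k => v 0 k * grad f y k 0)) => k.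
  by apply: cvgMl; exact: coord_continuous.
have main (e : R) : 0 < e ->
    \forall h \near (0 : 'rV[R]_n), `|f (h + y) - f y - dfL h| <= e * `|h|.
  move=> e0.
  pose e' := e / n.+1%:R; have e'0 : 0 < e' by rewrite divr_gt0.
  have /nbhs_ballP[r /= r0 rP] : \forall z \near y, D z /\ forall k : 'I_n,
     `|'D_(delta_mx 0 k) f z - 'D_(delta_mx 0 k) f y| < e'.
    have nD : \forall z \near y, D z by exact: open_nbhs_nbhs.
    have nG : \forall z \near y, forall k : 'I_n,
        `|'D_(delta_mx 0 k) f z - 'D_(delta_mx 0 k) f y| < e'.
      apply: (@filter_forall _ _ (fun (k : 'I_n) z =>
        `|'D_(delta_mx 0 k) f z - 'D_(delta_mx 0 k) f y| < e') (nbhs y)) => k.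
      have /cvgr_distC_lt := fc (delta_mx 0 k) y (mem_set Dy).
      by apply.
    exact: filterI nD nG.
  apply/nbhs_ballP; exists r => //= h; rewrite -ball_normE /= sub0r normrN => hr.
  (* p k keeps the first k coordinates of h: p 0 = 0, p n = h, and p k.+1 - p k
     is along one axis *)
  pose p (k : nat) : 'rV[R]_n := \row_j (if (j < k)%N then h 0 j else 0).
  have p_near k (t : R) (i : 'I_n) : 0 <= t <= 1 -> i = k :> nat ->
      `|p k + t *: (h 0 i *: delta_mx 0 i)| <= `|h|.
    move=> /andP[t0 t1] ik; apply: norm_le_coord => // j l.
    rewrite !mxE ord1 eqxx /=; have [->|li] := eqVneq l i.
      rewrite -ik ltnn add0r mulr1 normrM ger0_norm //.
      apply: le_trans (norm_coord_le h 0 i); exact: ler_piMl.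
    rewrite !mulr0 addr0; case: ifP => _; last by rewrite normr0.
    exact: norm_coord_le.
  have pS (i : 'I_n) : p i.+1 = p i + h 0 i *: delta_mx 0 i.
    apply/rowP => j; rewrite !mxE eqxx /= ltnS leq_eqVlt.
    have [->|ji] := eqVneq j i; first by rewrite eqxx ltnn add0r mulr1.
    by rewrite (negbTE (_ : (j != i :> nat))) //= mulr0 addr0.
  have p0 : p 0%N = 0 by apply/rowP => j; rewrite !mxE.
  have pn : p n = h by apply/rowP => j; rewrite !mxE ltn_ord.
  have step (i : 'I_n) :
      `|f (y + p i.+1) - f (y + p i) - h 0 i * grad f y i 0| <= e' * `|h|.
    have zD (t : R) : 0 <= t <= 1 ->
        let z := y + p i + t *: (h 0 i *: delta_mx 0 i) in
        D z /\ forall k : 'I_n,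
     `|'D_(delta_mx 0 k) f z - 'D_(delta_mx 0 k) f y| < e'.
      move=> t01 /=; apply: rP; rewrite -ball_normE /= -addrA opprD addNKr normrN.
      exact: le_lt_trans (p_near _ _ _ t01 erefl) hr.
    have [t t01] := @mean_value_line _ f (y + p i) (h 0 i *: delta_mx 0 i)
      (fun t t01 => fd _ _ (zD t t01).1).
    rewrite pS addrA => ->.
    rewrite derivable_deriveZv; last by apply: fd; have [] := zD _ t01.
    rewrite mxE -mulrBr normrM mulrC ler_pM //; last exact: norm_coord_le.
    by apply/ltW; have [_] := zD _ t01; apply.
  have -> : f (h + y) - f y - dfL h =
      \sum_(i < n) (f (y + p i.+1) - f (y + p i) - h 0 i * grad f y i 0).
    rewrite sumrB -(big_mkord xpredT (fun i => f (y + p i.+1) - f (y + p i))).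
    by rewrite telescope_sumr // p0 pn addr0 -dfE (addrC h).
  apply: le_trans (ler_norm_sum _ _ _) _.
  apply: le_trans (ler_sum _ (fun i _ => step i)) _.
  rewrite sumr_const card_ord -mulrnAl ler_wpM2r // /e' -mulr_natr mulrAC.
  by rewrite ler_pdivrMr // ler_pM2l // ler_nat.
have [dfy dfE'] := differentiable_linear_remainder cdf main.
by split=> // v; rewrite (deriveE _ dfy) dfE'.
Qed.

End Calculus.

Section Calculus2.
Context {R : realType}.

Lemma near_eq_cvg_at {T U : topologicalType} (f g : T -> U) (y : T) (l : U) :
  (\forall z \near y, f z = g z) -> f z @[z --> y] --> l -> g z @[z --> y] --> l.
Proof. by move=> fg; apply: cvg_trans; exact: near_eq_cvg. Qed.

Lemma C1_coord {n m} (D : set 'rV[R]_n) (T : 'rV[R]_n -> 'rV[R]_m) j :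
  open D -> Ck_on 1 D T -> Ck_on 1 D (fun y => T y 0 j : R^o).
Proof.
move=> oD [Tc Td TDc]; split.
- by move=> y Dy; exact: (cvg_coord (Tc y Dy)).
- by move=> y v Dy; move/derivable_mxP : (Td y v Dy); apply.
- move=> v y Dy; have Dy' : D y by exact: set_mem.
  have E z : D z -> 'D_v (fun y => T y 0 j) z = 'D_v T z 0 j.
    by move=> Dz; rewrite derive_mx ?mxE //; exact: Td.
  rewrite /continuous_at (E y) //.
  apply: (@near_eq_cvg_at _ _ (fun z => 'D_v T z 0 j)).
    by apply: filterS (open_nbhs_nbhs (conj oD Dy')) => z Dz; rewrite E.
  exact: (cvg_coord (TDc v y Dy)).
Qed.

Lemma C1_differentiable_mx {n m} (D : set 'rV[R]_n) (T : 'rV[R]_n -> 'rV[R]_m) y :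
  open D -> Ck_on 1 D T -> D y -> differentiable T y.
Proof.
move=> oD TC Dy.
rewrite (_ : T = \sum_j (fun y => T y 0 j *: (delta_mx 0 j : 'rV[R]_m))); last first.
  by apply/funext => z; rewrite fct_sumE; exact: row_sum_delta.
apply: differentiable_sum => j; apply: differentiableZl.
exact: (C1_differentiable oD (C1_coord j oD TC) Dy).1.
Qed.

Lemma C1_grad_continuous {n} (D : set 'rV[R]_n) (f : 'rV[R]_n -> R^o) y :
  Ck_on 1 D f -> D y -> grad f z @[z --> y] --> grad f y.
Proof.
move=> [_ _ fc] Dy; apply: (@cvg_mxP _ _ (nbhs y)) => k j; rewrite mxE.
under eq_cvg do rewrite mxE.
exact: (fc _ _ (mem_set Dy)).
Qed.

Lemma C1_comp {n m} (D : set 'rV[R]_n) (E : set 'rV[R]_m)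
    (f : 'rV[R]_m -> R^o) (T : 'rV[R]_n -> 'rV[R]_m) :
  open D -> open E -> Ck_on 1 D T -> Ck_on 1 E f -> (forall y, D y -> E (T y)) ->
  Ck_on 1 D (f \o T : _ -> R^o).
Proof.
move=> oD oE TC fC DE.
have dT y : D y -> differentiable T y by exact: C1_differentiable_mx.
have df y : D y -> differentiable f (T y).
  by move=> Dy; have [] := C1_differentiable oE fC (DE _ Dy).
have dfT y : D y -> differentiable (f \o T) y.
  by move=> Dy; apply: differentiable_comp; [exact: dT|exact: df].
have DfT y v : D y -> 'D_v (f \o T) y = ('D_v T y *m grad f (T y)) 0 0.
  move=> Dy; rewrite (deriveE _ (dfT _ Dy)) (diff_comp (dT _ Dy) (df _ Dy)) /=.
  rewrite -(deriveE _ (df _ Dy)) -(deriveE _ (dT _ Dy)).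
  by have [_] := C1_differentiable oE fC (DE _ Dy); apply.
split.
- move=> y Dy; apply: (@differentiable_continuous _ _ _ y (f \o T)).
  by apply: dfT; exact: set_mem.
- by move=> y v Dy; apply: diff_derivable; exact: dfT.
- move=> v y Dy; have Dy' : D y by exact: set_mem.
  rewrite /continuous_at DfT //.
  apply: (@near_eq_cvg_at _ _ (fun z => ('D_v T z *m grad f (T z)) 0 0)).
    by apply: filterS (open_nbhs_nbhs (conj oD Dy')) => z Dz; rewrite DfT.
  have Tc := differentiable_continuous (dT _ Dy').
  have gc : grad f (T z) @[z --> y] --> grad f (T y).
    exact: (continuous_comp Tc (C1_grad_continuous fC (DE _ Dy'))).
  have [_ _ TDc] := TC; exact: (cvg_coord (cvg_mulmx (TDc v y Dy) gc)).
Qed.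

Lemma grad_comp {n m} (f : 'rV[R]_m -> R^o) (T : 'rV[R]_n -> 'rV[R]_m)
    (E : set 'rV[R]_m) y :
  differentiable T y -> open E -> Ck_on 1 E f -> E (T y) ->
  grad (f \o T) y = 'J T y *m grad f (T y).
Proof.
move=> dT oE fC ETy; have [df dfE] := C1_differentiable oE fC ETy.
have dfT : differentiable (f \o T) y by exact: differentiable_comp.
apply/colP => k; rewrite mxE (deriveE _ dfT) (diff_comp dT df) /=.
rewrite -(deriveE _ df) -(deriveE _ dT) dfE deriveEjacobian //.
by rewrite -mulmxA -rowE mxE.
Qed.

Lemma C1_subset {V : normedModType R} n (D D' : set 'rV[R]_n) (f : 'rV[R]_n -> V) :
  D' `<=` D -> Ck_on 1 D f -> Ck_on 1 D' f.
Proof.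
move=> DD [fc fd fDc]; split.
- by move=> y /set_mem/DD/mem_set; exact: fc.
- by move=> y v /DD; exact: fd.
- by move=> v y /set_mem/DD/mem_set; exact: fDc.
Qed.

Definition C1at {n} (f : 'rV[R]_n -> R) (y : 'rV[R]_n) : Prop :=
  exists2 D, open_nbhs y D & Ck_on 1 D (f : _ -> R^o).

Lemma C1atP {n} (f : 'rV[R]_n -> R) (y : 'rV[R]_n) : C1at f y ->
  [/\ differentiable (f : _ -> R^o) y, f z @[z --> y] --> f y,
      grad f z @[z --> y] --> grad f y & \forall z \near y, C1at f z].
Proof.
move=> [D [oD Dy] fC]; have [df _] := C1_differentiable oD fC Dy.
split=> //; first exact: (differentiable_continuous df).
  exact: C1_grad_continuous fC Dy.
by apply: filterS (open_nbhs_nbhs (conj oD Dy)) => z Dz; exists D.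
Qed.

Lemma C1_of_derive {n} (D : set 'rV[R]_n) (f : 'rV[R]_n -> R^o)
    (df : 'rV[R]_n -> 'cV[R]_n) :
  open D ->
  (forall y v, D y -> is_derive y v f ((v *m df y) 0 0)) ->
  {in D, continuous df} ->
  {in D, continuous f} ->
  Ck_on 1 D f /\ forall y, D y -> grad f y = df y.
Proof.
move=> oD fd dfc fc; split; first split=> //.
- by move=> y v Dy; have [] := fd y v Dy.
- move=> v y Dy; have Dy' : D y by exact: set_mem.
  have E z : D z -> 'D_v f z = (v *m df z) 0 0 by move=> Dz; have [] := fd z v Dz.
  rewrite /continuous_at E //.
  apply: (@near_eq_cvg_at _ _ (fun z => (v *m df z) 0 0)).
    by apply: filterS (open_nbhs_nbhs (conj oD Dy')) => z Dz; rewrite E.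
  exact: (cvg_coord (cvg_mulmx (@cvg_cst _ v _ (nbhs y) _) (dfc y Dy))).
- move=> y Dy; apply/colP => k; rewrite mxE.
  have [_ ->] := fd y (delta_mx 0 k) Dy; by rewrite -rowE mxE.
Qed.

Lemma C1_oppr {n} (D : set 'rV[R]_n) (f : 'rV[R]_n -> R^o) : open D ->
  Ck_on 1 D f -> Ck_on 1 D (fun y => - f y : R^o) /\
  forall y, D y -> grad (fun y => - f y) y = - grad f y.
Proof.
move=> oD fC; apply: (@C1_of_derive _ _ _ (fun y => - grad f y)) => //.
- move=> y v Dy; rewrite mulmxN mxE.
  have [df E] := C1_differentiable oD fC Dy; rewrite -E.
  by apply: is_deriveN; apply: derivableP; exact: diff_derivable.
- by move=> y Dy; exact: (cvgN (C1_grad_continuous fC (set_mem Dy))).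
- by move=> y Dy; have [fc _ _] := fC; exact: (cvgN (fc y Dy)).
Qed.

Lemma C1_addr {n} (D : set 'rV[R]_n) (f g : 'rV[R]_n -> R^o) : open D ->
  Ck_on 1 D f -> Ck_on 1 D g -> Ck_on 1 D (fun y => f y + g y : R^o) /\
  forall y, D y -> grad (fun y => f y + g y) y = grad f y + grad g y.
Proof.
move=> oD fC gC; apply: (@C1_of_derive _ _ _ (fun y => grad f y + grad g y)) => //.
- move=> y v Dy; rewrite mulmxDr mxE.
  have [df E] := C1_differentiable oD fC Dy; rewrite -E.
  have [dg E'] := C1_differentiable oD gC Dy; rewrite -E'.
  by apply: is_deriveD; apply: derivableP; exact: diff_derivable.
- move=> y Dy; have Dy' := set_mem Dy.
  exact: (cvgD (C1_grad_continuous fC Dy') (C1_grad_continuous gC Dy')).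
- move=> y Dy; have [fc _ _] := fC; have [gc _ _] := gC.
  exact: (cvgD (fc y Dy) (gc y Dy)).
Qed.

Lemma C1at_opp {n} (f : 'rV[R]_n -> R) y : C1at f y ->
  C1at (fun y => - f y) y /\ grad (fun y => - f y) y = - grad f y.
Proof.
by move=> [D [oD Dy] fC]; have [NC NE] := C1_oppr oD fC; split; [exists D|exact: NE].
Qed.

Lemma C1at_add {n} (f g : 'rV[R]_n -> R) y : C1at f y -> C1at g y ->
  C1at (fun y => f y + g y) y /\ grad (fun y => f y + g y) y = grad f y + grad g y.
Proof.
move=> [D [oD Dy] fC] [E [oE Ey] gC].
have oDE := openI oD oE.
have [SC SE] := C1_addr oDE (C1_subset (@subIsetl _ _ _) fC) (C1_subset (@subIsetr _ _ _) gC).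
by split; [exists (D `&` E)|rewrite SE].
Qed.

Lemma is_derive_coord {n} (y v : 'rV[R]_n) k :
  is_derive y v (fun z : 'rV[R]_n => z 0 k : R^o) (v 0 k).
Proof.
have did : derivable (id : 'rV[R]_n -> _) y v by exact: derivable_id.
apply: DeriveDef; first by move/derivable_mxP : did; apply.
by have := derive_mx did; rewrite derive_id => /matrixP/(_ 0 k); rewrite !mxE.
Qed.

(** The squared Euclidean length.  The norm of ['rV[R]_n] is the sup norm, which
    is not smooth and cannot serve in test functions. *)
Definition sqn {n} (y : 'rV[R]_n) : R := \sum_k y 0 k ^+ 2.

Lemma is_derive_sqn {n} (a y v : 'rV[R]_n) :
  is_derive y v (fun z : 'rV[R]_n => sqn (z - a) : R^o)
    ((v *m (2 *: (y - a)^T)) 0 0).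
Proof.
pose h k := (fun z : 'rV[R]_n => z 0 k - a 0 k : R^o).
have ih k : is_derive y v (h k) (v 0 k).
  have H1 := @is_derive_coord n y v k.
  have H2 := @is_derive_cst R _ _ (a 0 k : R^o) y v.
  by have := is_deriveB H1 H2; rewrite subr0.
have hs k : is_derive y v (fun z => h k z ^+ 2 : R^o) (2 * v 0 k * (y 0 k - a 0 k)).
  rewrite [X in is_derive _ _ X _](_ : _ = (h k : _ -> R) ^+ 2); last first.
    by apply/funext => z; rewrite exprfctE.
  apply: is_derive_eq.
  by rewrite /h expr1 /GRing.scale /=; ring.
have := is_derive_sum hs.
rewrite (_ : \sum_k (fun z => h k z ^+ 2) = (fun z => sqn (z - a))); last first.
  apply/funext => z; rewrite fct_sumE; apply: eq_bigr => k _.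
  by rewrite /h !mxE.
move/is_derive_eq; apply; rewrite mxE; apply: eq_bigr => k _.
by rewrite !mxE; ring.
Qed.

End Calculus2.

Section Calculus3.
Context {R : realType}.

Lemma sqn_ge0 {n} (y : 'rV[R]_n) : 0 <= sqn y.
Proof. by apply: sumr_ge0 => k _; exact: sqr_ge0. Qed.

Lemma sqn0 {n} : sqn (0 : 'rV[R]_n) = 0.
Proof. by rewrite /sqn big1 // => k _; rewrite mxE expr0n. Qed.

Lemma normr_sqr_le_sqn {n} (y : 'rV[R]_n) : `|y| ^+ 2 <= sqn y.
Proof.
rewrite -(sqr_sqrtr (sqn_ge0 y)) ler_sqr ?nnegrE ?sqrtr_ge0 //.
apply: norm_le_coord => [|i k]; first exact: sqrtr_ge0.
rewrite -sqrtr_sqr ler_sqrt ?sqn_ge0 // ord1 /sqn (bigD1 k) //= lerDl.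
by apply: sumr_ge0 => l _; exact: sqr_ge0.
Qed.

Lemma sqn_le_norm {n} (y : 'rV[R]_n) : sqn y <= n%:R * `|y| ^+ 2.
Proof.
rewrite /sqn -[n in n%:R]card_ord mulr_natl -sumr_const; apply: ler_sum => k _.
by rewrite -real_normK ?num_real // lerXn2r ?nnegrE // norm_coord_le.
Qed.

Lemma norm_trmx {m n} (y : 'M[R]_(m, n)) : `|y^T| = `|y|.
Proof.
apply/eqP; rewrite eq_le; apply/andP; split; apply: norm_le_coord => // i j.
  by rewrite mxE norm_coord_le.
by have := norm_coord_le y^T j i; rewrite mxE.
Qed.

Lemma cvg_nbhs_dist {T : topologicalType} {V : normedModType R} (f : T -> V) (y : T) (l : V) :
  (forall e : R, 0 < e -> \forall z \near y, `|l - f z| < e) ->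
  f z @[z --> y] --> l.
Proof. by move=> fy; apply/cvgrPdist_lt. Qed.

Lemma nbhs_dist {T : topologicalType} {V : normedModType R} (f : T -> V) (y : T) (l : V) :
  f z @[z --> y] --> l ->
  (forall e : R, 0 < e -> \forall z \near y, `|l - f z| < e).
Proof. by move=> /cvgrPdist_lt. Qed.

Lemma near_dist {V : normedModType R} (y : V) (e : R) :
  0 < e -> \forall z \near y, `|y - z| < e.
Proof. exact: cvgr_dist_lt. Qed.

Lemma near_distC {V : normedModType R} (y : V) (e : R) :
  0 < e -> \forall z \near y, `|z - y| < e.
Proof. by move=> e0; apply: filterS (near_dist y e0) => z; rewrite distrC. Qed.

Lemma trmx_continuous {m n} : continuous (trmx : 'M[R]_(m, n) -> 'M[R]_(n, m)).
Proof.
move=> y; apply: cvg_nbhs_dist => e e0.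
by apply: filterS (near_dist y e0) => z; rewrite -linearB norm_trmx.
Qed.

Lemma C1at_cst {n} (k : R) (y : 'rV[R]_n) : C1at (fun=> k) y /\ grad (fun=> k) y = 0.
Proof.
have [||||C E] := @C1_of_derive R n setT (fun=> k : R^o) (fun=> 0).
- exact: openT.
- by move=> z v _; rewrite mulmx0 mxE; exact: is_derive_cst.
- by move=> z _; exact: (@cvg_cst _ (0 : 'cV[R]_n) _ (nbhs z) _).
- by move=> z _; exact: (@cvg_cst _ (k : R^o) _ (nbhs z) _).
- by split; [exists setT => //; split=> //; exact: openT|exact: E].
Qed.

Lemma is_derive_linform {n} (p : 'cV[R]_n) (y v : 'rV[R]_n) :
  is_derive y v (fun z : 'rV[R]_n => (z *m p) 0 0 : R^o) ((v *m p) 0 0).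
Proof.
have hs k : is_derive y v (p k 0 *: (fun z : 'rV[R]_n => z 0 k : R^o)) (p k 0 *: v 0 k).
  have H := @is_derive_coord _ _ y v k.
  exact: is_deriveZ.
have := is_derive_sum hs.
rewrite (_ : \sum_k (p k 0 *: _) = (fun z : 'rV[R]_n => (z *m p) 0 0 : R^o)); last first.
  apply/funext => z; rewrite fct_sumE mxE; apply: eq_bigr => k _.
  by rewrite mulrC.
by move/is_derive_eq; apply; rewrite mxE; apply: eq_bigr => k _; rewrite mulrC.
Qed.

Lemma C1at_linform {n} (p : 'cV[R]_n) (y : 'rV[R]_n) :
  C1at (fun z => (z *m p) 0 0) y /\ grad (fun z => (z *m p) 0 0) y = p.
Proof.
have [||||C E] := @C1_of_derive R n setT (fun z => (z *m p) 0 0 : R^o) (fun=> p).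
- exact: openT.
- by move=> z v _; exact: is_derive_linform.
- by move=> z _; exact: (@cvg_cst _ p _ (nbhs z) _).
- move=> z _.
  exact: (cvg_coord (cvg_mulmx (@cvg_id _ (nbhs z)) (@cvg_cst _ p _ (nbhs z) _))).
- by split; [exists setT => //; split=> //; exact: openT|exact: E].
Qed.

Lemma grad_near_eq {n} (f g : 'rV[R]_n -> R) y :
  (\forall z \near y, f z = g z) -> grad f y = grad g y.
Proof.
by move=> fg; apply/colP => k; rewrite !mxE; exact: near_eq_derive.
Qed.

Lemma C1_sqn {n} (a : 'rV[R]_n) (D : set 'rV[R]_n) : open D ->
  Ck_on 1 D (fun z => sqn (z - a) : R^o) /\
  forall y, D y -> grad (fun z => sqn (z - a)) y = 2 *: (y - a)^T.
Proof.
move=> oD; apply: C1_of_derive => // [y v Dy|y Dy|y Dy].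
- exact: is_derive_sqn.
- apply: (@cvg_mxP _ _ (nbhs y)) => k j; rewrite !mxE.
  under eq_cvg do rewrite !mxE.
  rewrite ord1; apply: cvgMr; apply: cvgB; last exact: cvg_cst.
  exact: coord_continuous.
- have H k : (z - a) 0 k @[z --> y] --> (y - a) 0 k.
    rewrite !mxE; under eq_cvg do rewrite !mxE.
    exact: (cvgB (@coord_continuous R 1 n 0 k y) (@cvg_cst _ (a 0 k) _ (nbhs y) _)).
  exact: (@cvg_sumR _ _ (nbhs y) _ _ _ _ (fun k => cvgM (H k) (H k))).
Qed.

Lemma sqn_continuous {n} (a y : 'rV[R]_n) :
  sqn (z - a) @[z --> y] --> sqn (y - a).
Proof.
have [[fc _ _] _] := @C1_sqn n a setT openT.
by apply: fc; rewrite inE.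
Qed.

Lemma C1_radial {n} (a : 'rV[R]_n) (D : set 'rV[R]_n) (psi dpsi : R -> R) :
  open D ->
  (forall y, D y -> is_derive (sqn (y - a)) 1 psi (dpsi (sqn (y - a)))) ->
  (forall y, D y -> {for sqn (y - a), continuous dpsi}) ->
  Ck_on 1 D (fun z => psi (sqn (z - a)) : R^o) /\
  forall y, D y -> grad (fun z => psi (sqn (z - a))) y =
                   (2 * dpsi (sqn (y - a))) *: (y - a)^T.
Proof.
move=> oD dp cp; have [sC sG] := C1_sqn a oD.
pose s (z : 'rV[R]_n) : R^o := sqn (z - a).
have sG' y : D y -> grad s y = 2 *: (y - a)^T by exact: sG.
have ds y : D y -> differentiable s y.
  by move=> Dy; have [] := C1_differentiable oD sC Dy.
have dpd y : D y -> differentiable (psi : R -> R^o) (s y).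
  by move=> Dy; apply/derivable1_diffP; have [] := dp y Dy.
have dps y : D y -> differentiable ((psi : R -> R^o) \o s) y.
  by move=> Dy; apply: differentiable_comp; [exact: ds|exact: dpd].
suff H : Ck_on 1 D ((psi : R -> R^o) \o s) /\ forall y, D y ->
    grad ((psi : R -> R^o) \o s) y = (dpsi (s y)) *: grad s y.
  have [H1 H2] := H; split=> // y Dy.
  by rewrite H2 // sG' // scalerA mulrC.
apply: C1_of_derive => // [y v Dy|y /set_mem Dy|y /set_mem Dy].
- apply: DeriveDef; first exact: diff_derivable (dps y Dy).
  rewrite (deriveE _ (dps y Dy)) (diff_comp (ds y Dy) (dpd y Dy)) /=.
  rewrite -(deriveE _ (ds y Dy)); have [_ ->] := C1_differentiable oD sC Dy.
  have -> : forall c : R, 'd (psi : R -> R^o) (s y) c = c * dpsi (s y).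
    move=> c; rewrite -[c in 'd _ _ c]mulr1 -/(c *: (1 : R)) linearZ /=; congr (_ * _).
    by rewrite -(deriveE _ (dpd y Dy)); have [_ ->] := dp y Dy.
  by rewrite -scalemxAr [RHS]mxE mulrC.
- have gc := C1_grad_continuous sC Dy.
  apply: (@cvgZ _ _ _ (nbhs y)) => //.
  exact: (continuous_comp (@sqn_continuous n a y) (cp y Dy)).
- exact: differentiable_continuous (dps y Dy).
Qed.

(** The first-order condition for f - g, read along each axis. *)
Lemma grad_local_max {n} (f g : 'rV[R]_n -> R) y : C1at f y -> C1at g y ->
  (\forall z \near y, f z - g z <= f y - g y) -> grad f y = grad g y.
Proof.
move=> fC /C1at_opp[gC gE] fg.
have [hC hE] := C1at_add fC gC; set h := (fun z => _) in hC hE.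
apply/eqP; rewrite -subr_eq0 -gE -hE; apply/eqP/colP => k; rewrite !mxE.
have [dh _ _ _] := C1atP hC; set v := delta_mx 0 k.
have dhv : derivable (h : _ -> R^o) (y + 0 *: v) v.
  by rewrite scale0r addr0; exact: diff_derivable.
have := is_derive_line dhv; rewrite scale0r addr0 => -[_ <-].
have : \forall t \near (0 : R), derivable (h : _ -> R^o) (y + t *: v) v /\
   h (y + t *: v) <= h y.
  have vc : (y + t *: v) @[t --> (0 : R)] --> y + 0 *: v.
    by apply: cvgD; [exact: cvg_cst|exact: scalel_continuous].
  rewrite scale0r addr0 in vc.
  have /vc : \forall z \near y, derivable (h : _ -> R^o) z v /\ h z <= h y.
    have [_ _ _ nC] := C1atP hC.
    apply: filterS2 nC fg => z /C1atP[dz _ _ _] ?; split=> //.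
    exact: diff_derivable.
  by [].
move=> /nbhs_ballP[r /= r0 rP].
have P (t : R) : t \in `](- r), r[ -> derivable (h : _ -> R^o) (y + t *: v) v /\
   h (y + t *: v) <= h y.
  rewrite in_itv /= => tr; apply: rP; rewrite -ball_normE /= sub0r normrN.
  by rewrite ltr_norml.
have := @derive1_at_max R (fun t : R => h (y + t *: v)) (- r) r 0.
case.
- by lra.
- by move=> t /P[/is_derive_line[]].
- by rewrite in_itv /=; lra.
- by move=> t /P[_]; rewrite scale0r addr0.
by [].
Qed.

End Calculus3.

(** * Functions touched from above by C1 functions *)

Section Touching.
Context {R : realType} {n : nat}.
Implicit Types (w : 'rV[R]_n -> R) (y z : 'rV[R]_n) (q : 'cV[R]_n).

(** q lies in the (C1) superdifferential of w at y. *)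
Definition supergrad w y q : Prop := exists f, [/\ C1at f y,
  \forall z \near y, w z - f z <= w y - f y & grad f y = q].

Lemma closed_ball_compact y (r : R) : compact [set z | `|z - y| <= r].
Proof.
apply: bounded_closed_compact.
  exists (`|y| + r); split; first exact: num_real.
  move=> M yM z /= zy; apply: ltW; apply: le_lt_trans yM.
  by rewrite -[z](subrK y) addrC (le_trans (ler_normD _ _)) ?lerD2l // addrK.
rewrite (_ : mkset _ = (fun z => `|z - y|) @^-1` [set t | t <= r]) //.
apply: closed_comp; last exact: closed_le.
move=> z _.
exact: (cvg_norm (cvgB (@cvg_id _ (nbhs z)) (@cvg_cst _ y _ (nbhs z) _))).
Qed.

Lemma attains_max w y (r : R) :
  0 <= r -> (forall z, `|z - y| <= r -> {for z, continuous w}) ->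
  exists2 z, `|z - y| <= r & forall t, `|t - y| <= r -> w t <= w z.
Proof.
move=> r0 wc.
have [||z zy zP] := @compact_EVT_max _ _ w _ _ (@closed_ball_compact y r).
- by exists y; rewrite /= subrr normr0.
- by apply: continuous_in_subspaceT => z /set_mem; exact: wc.
- exists z => [|t ty]; first exact: set_mem.
  by apply: zP; exact: mem_set.
Qed.

(** Adding the squared distance to y0 to the test function makes the contact
    strict.  A function w' that exceeds w by little near y0, and is almost as
    large at y0, then has an interior maximum against this test function, hence
    a contact point near y0 with almost the same gradient. *)
Lemma supergrad_stable w y0 q (e : R) :
  0 < e -> {for y0, continuous w} -> supergrad w y0 q ->
  exists2 d : R, 0 < d & forall w',
    (forall z, `|z - y0| < e -> {for z, continuous w'}) ->
    (forall z, `|z - y0| < e -> w' z <= w z + d) -> w y0 - d <= w' y0 ->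
    exists y q', [/\ `|y - y0| < e, `|q' - q| < e, `|w' y - w y0| < e &
      supergrad w' y q'].
Proof.
move=> e0 wc [f [fC wf <-]].
have [_ fc gc nC] := C1atP fC.
have e4 : 0 < e / 4 by rewrite divr_gt0.
have nf := nbhs_dist fc e4.
have ng := nbhs_dist gc e4.
have nw := nbhs_dist wc e4.
have /nbhs_ballP[r /= r0 rP] : \forall z \near y0,
  [/\ C1at f z, w z - f z <= w y0 - f y0, `|f y0 - f z| < e / 4,
      `|grad f y0 - grad f z| < e / 4 & `|w y0 - w z| < e / 4].
  by near=> z; split; near: z.
pose s := Num.min (r / 2) (e / 8).
have s0 : 0 < s by rewrite lt_min !divr_gt0.
have sr z : `|z - y0| <= s -> [/\ C1at f z, w z - f z <= w y0 - f y0, `|f y0 - f z| < e / 4,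
      `|grad f y0 - grad f z| < e / 4 & `|w y0 - w z| < e / 4].
  move=> zs; apply: rP; rewrite -ball_normE /= distrC; apply: le_lt_trans zs _.
  by rewrite gt_min ltr_pdivrMr // ltr_pMr // ltr1n.
have se : s <= e / 8 by rewrite ge_min lexx orbT.
pose d := Num.min (s ^+ 2 / 3) (e / 4).
have d0 : 0 < d by rewrite lt_min !divr_gt0 // exprn_gt0.
exists d => // w' w'c w'le w'y0.
have ze z : `|z - y0| <= s -> `|z - y0| < e.
  by move/le_lt_trans; apply; lra.
pose F z := w' z - (f z + sqn (z - y0)).
have Fc z : `|z - y0| <= s -> {for z, continuous F}.
  move=> zs; have [/C1atP[_ fcz _ _] _ _ _ _] := sr z zs.
  have w'cz := w'c z (ze _ zs).
  exact: (cvgB w'cz (cvgD fcz (@sqn_continuous _ _ y0 z))).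
have [y ys yP] := attains_max (ltW s0) Fc.
have d1 : d <= s ^+ 2 / 3 by rewrite ge_min lexx.
have d2 : d <= e / 4 by rewrite ge_min lexx orbT.
have := yP y0; rewrite subrr normr0 => /(_ (ltW s0)).
rewrite /F subrr sqn0 addr0.
have [fCy wfy fy gy wy] := sr y ys.
have w'y := w'le y (ze _ ys).
move=> Fy; have sq0 := sqn_ge0 (y - y0).
have ys' : `|y - y0| < s.
  rewrite -ltr_sqr ?nnegrE ?(ltW s0) //.
  by have s2 := exprn_gt0 2 s0; apply: le_lt_trans (normr_sqr_le_sqn _) _; lra.
have [qC qG] := @C1_sqn _ _ y0 setT openT.
have sC : C1at (fun z => sqn (z - y0)) y by exists setT => //; split=> //; exact: openT.
have [SC SG] := C1at_add fCy sC.
exists y, (grad f y + 2 *: (y - y0)^T); split; first exact: ze.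
- rewrite -addrAC; apply: le_lt_trans (ler_normD _ _) _.
  by rewrite normrZ norm_trmx distrC ger0_norm //; lra.
- move: fy wy; rewrite !ltr_norml ltrBlDr => /andP[? ?] /andP[? ?].
  apply/andP; split; lra.
- exists (fun z => f z + sqn (z - y0)); split=> //; last by rewrite SG qG.
  have sy : 0 < s - `|y - y0| by rewrite subr_gt0.
  apply: filterS (near_dist y sy) => z yz; apply: yP.
  have := ler_normD (y - y0) (z - y); rewrite addrC addrA subrK.
  by move: yz; rewrite distrC => yz; lra.
Unshelve. all: by end_near. Qed.

(** Exceeds the Euclidean length of every covector of sup norm at most r. *)
Definition slope (r : R) := n.+1%:R * (`|r| + 1).

(** A cone with vertex y1 and slope larger than all test gradients cannot touch
    w from above outside its vertex.  To keep the contact point away from the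
    boundary of the ball, a multiple of the m-th power of (squared distance / s)
    is added, adapted to the oscillation of w; well inside the ball this term
    tends to 0 as m grows, so the resulting bound does not depend on w. *)
Lemma supergrad_bound_lipschitz w y0 (rho r : R) :
  0 < rho ->
  (forall z, `|z - y0| < rho -> {for z, continuous w}) ->
  (forall z q, `|z - y0| < rho -> supergrad w z q -> `|q| <= r) ->
  forall y1 y2, `|y1 - y0| < rho / 2 -> sqn (y2 - y1) < (rho / 2) ^+ 2 / 2 ->
  w y2 - w y1 <= slope r * Num.sqrt (sqn (y2 - y1)).
Proof.
move=> rho0 wc wq y1 y2 y1y0 sy2.
set s := (rho / 2) ^+ 2 in sy2 *.
have rho20 : 0 < rho / 2 by rewrite divr_gt0.
have s0 : 0 < s by rewrite exprn_gt0.
set L := slope r.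
have L0 : 0 < L by rewrite /L /slope mulr_gt0 // ltr_wpDl.
have inball z : `|z - y1| <= rho / 2 -> `|z - y0| < rho.
  move=> zy1; have := ler_normD (z - y1) (y1 - y0); rewrite addrA subrK.
  by move=> h; lra.
have wc1 z : `|z - y1| <= rho / 2 -> {for z, continuous w} by move/inball/wc.
have [W W0 wW] : exists2 W, 0 <= W & forall z, `|z - y1| <= rho / 2 -> w z - w y1 <= W.
  have [z0 z01 z0P] := attains_max (ltW rho20) wc1.
  exists (w z0 - w y1); last by move=> z /z0P; rewrite lerD2r.
  by rewrite subr_ge0 z0P // subrr normr0 ltW.
have sqn00 : sqn (y1 - y1) = 0 by rewrite subrr sqn0.
have bound (m : nat) : w y2 - w y1 <=
    L * Num.sqrt (sqn (y2 - y1)) + (W + 1) / s ^+ m.+1 * sqn (y2 - y1) ^+ m.+1.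
  set c := (W + 1) / s ^+ m.+1.
  have c0 : 0 < c by rewrite divr_gt0 ?exprn_gt0 // ltr_wpDl.
  pose psi (t : R) := L * Num.sqrt t + c * t ^+ m.+1.
  pose dpsi (t : R) := L / (2 * Num.sqrt t) + c * (m.+1%:R * t ^+ m).
  have psi0 : psi 0 = 0 by rewrite /psi sqrtr0 expr0n !mulr0 addr0.
  have psic : continuous psi.
    move=> t; apply: cvgD; apply: cvgMr; first exact: sqrt_continuous.
    exact: exprn_continuous.
  have psid (t : R) : 0 < t -> is_derive t 1 psi (dpsi t).
    move=> t0; have H1 := is_derive1_sqrt t0.
    have H2 : is_derive t 1 (fun t : R => t ^+ m.+1) (m.+1%:R * t ^+ m).
      apply: DeriveDef; first exact: exprn_derivable.
      by rewrite exp_derive /= [LHS]mulr1.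
    exact: (is_deriveD (is_deriveZ L H1) (is_deriveZ c H2)).
  have dpsic (t : R) : 0 < t -> {for t, continuous dpsi}.
    move=> t0; apply: cvgD; apply: cvgMr; last first.
      by apply: cvgMr; exact: exprn_continuous.
    apply: cvgV; first by rewrite mulf_neq0 // gt_eqF // sqrtr_gt0.
    by apply: cvgMr; exact: sqrt_continuous.
  pose F z := w z - psi (sqn (z - y1)).
  have Fc z : `|z - y1| <= rho / 2 -> {for z, continuous F}.
    move=> /wc1 wcz.
    exact: (cvgB wcz (continuous_comp (@sqn_continuous _ _ y1 z) (psic _))).
  have [y yy1 yP] := attains_max (ltW rho20) Fc.
  have Fy1 : F y1 = w y1 by rewrite /F sqn00 psi0 subr0.
  have ys : sqn (y - y1) < s.
    rewrite ltNge; apply/negP => sy.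
    have := yP y1; rewrite Fy1 subrr normr0 => /(_ (ltW rho20)).
    have := wW y yy1; rewrite /F.
    have : W + 1 <= psi (sqn (y - y1)).
      rewrite /psi ler_wpDl //; first by rewrite mulr_ge0 ?sqrtr_ge0 // ltW.
      rewrite /c mulrAC ler_pdivlMr ?exprn_gt0 //.
      rewrite ler_wpM2l //; first by rewrite addr_ge0.
      by rewrite lerXn2r // ?nnegrE ?sqn_ge0 ?(ltW s0) //.
    by move=> *; lra.
  have in_s z : sqn (z - y1) < s -> `|z - y1| < rho / 2.
    move=> zs; rewrite -ltr_sqr ?nnegrE ?(ltW rho20) //.
    exact: le_lt_trans (normr_sqr_le_sqn _) zs.
  (* y is the contact point: either it is the vertex, and the claim follows by
     evaluating F at y2, or the test function is smooth at y *)
  have [yE|yN] := eqVneq (sqn (y - y1)) 0.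
    have y2s : sqn (y2 - y1) < s by lra.
    have := yP y2 (ltW (in_s _ y2s)).
    have -> : y = y1.
      apply/eqP; rewrite -subr_eq0 -normr_eq0 -sqrf_eq0 eq_le sqr_ge0 andbT.
      by rewrite -yE normr_sqr_le_sqn.
    by rewrite Fy1 /F /psi lerBlDr addrC -lerBlDr.
  have t0 : 0 < sqn (y - y1) by rewrite lt_def yN sqn_ge0.
  pose D := [set z | 0 < sqn (z - y1)].
  have oD : open D.
    apply: (@open_comp _ _ (fun z => sqn (z - y1)) [set t : R | 0 < t]).
      by move=> z _; exact: sqn_continuous.
    exact: open_gt.
  have [pC pG] := @C1_radial R n y1 D psi dpsi oD
    (fun z Dz => psid _ Dz) (fun z Dz => dpsic _ Dz).
  have wy : supergrad w y ((2 * dpsi (sqn (y - y1))) *: (y - y1)^T).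
    exists (fun z => psi (sqn (z - y1))); split.
    - by exists D.
    - have ry : 0 < rho / 2 - `|y - y1| by rewrite subr_gt0 in_s.
      apply: filterS (near_dist y ry) => z yz; apply: yP.
      have := ler_normD (y - y1) (z - y); rewrite addrC addrA subrK.
      by move: yz; rewrite distrC => yz h; apply: le_trans h _; rewrite -lerBrDl ltW.
    - exact: pG.
  have := wq y _ (inball _ yy1) wy; set q := _ *: _ => qr.
  have := sqn_le_norm q^T; rewrite norm_trmx leNgt => /negP[].
  set t := sqn (y - y1) in t0 q qr *.
  have -> : sqn q^T = (2 * dpsi t) ^+ 2 * t.
    by rewrite /t /sqn mulr_sumr; apply: eq_bigr => k _; rewrite !mxE exprMn.
  (* the gradient of the test function at y has Euclidean length at least L *)
  have dpL : L <= 2 * dpsi t * Num.sqrt t.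
    rewrite /dpsi mulrDr mulrDl ler_wpDr //.
      apply: mulr_ge0; last exact: sqrtr_ge0.
      apply: mulr_ge0 => //; apply: mulr_ge0; first exact: ltW.
      by apply: mulr_ge0 => //; exact: exprn_ge0 (ltW t0).
    have st0 : Num.sqrt t != 0 by rewrite gt_eqF // sqrtr_gt0.
    rewrite (_ : 2 * (L / (2 * Num.sqrt t)) * Num.sqrt t = L) //.
    by field; rewrite st0.
  have rL : n%:R * `|q| ^+ 2 < L ^+ 2.
    rewrite /L /slope exprMn; apply: (@le_lt_trans _ _ (n%:R * (`|r| + 1) ^+ 2)).
      rewrite ler_wpM2l // lerXn2r ?nnegrE ?addr_ge0 //; apply: le_trans qr _.
      by rewrite ler_wpDr // ler_norm.
    rewrite ltr_pM2r ?exprn_gt0 ?ltr_wpDl //.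
    rewrite expr2 -natrM ltr_nat; exact: (@leq_pmulr n.+1 n.+1).
  apply: lt_le_trans rL _.
  have -> : (2 * dpsi t) ^+ 2 * t = (2 * dpsi t * Num.sqrt t) ^+ 2.
    by rewrite [RHS]exprMn sqr_sqrtr // ltW.
  by rewrite ler_sqr // nnegrE ?(ltW L0) // (le_trans (ltW L0)).
rewrite lerBlDr; apply/ler_addgt0Pr => e e0.
set k := sqn (y2 - y1) / s.
have k0 : 0 <= k by rewrite divr_ge0 ?sqn_ge0 // ltW.
have k1 : k < 1 by rewrite ltr_pdivrMr // mul1r; lra.
have := @cvg_expr R k; rewrite ger0_norm // => /(_ k1) /cvgr_dist_lt.
have W1 : 0 < W + 1 by rewrite ltr_wpDl.
have e'0 : 0 < e / (W + 1) by rewrite divr_gt0.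
move=> /(_ _ e'0) [N _ NP].
have := NP N.+1 (leqnSn N); rewrite /= sub0r normrN ger0_norm ?exprn_ge0 //.
rewrite ltr_pdivlMr // => ke; have := bound N.
have -> : (W + 1) / s ^+ N.+1 * sqn (y2 - y1) ^+ N.+1 = k ^+ N.+1 * (W + 1).
  by rewrite /k expr_div_n mulrC mulrA mulrAC.
set u := L * _; set v := _ * _ in ke *.
by move: ke; rewrite -/v => *; lra.
Qed.

End Touching.

(** * Test functions in charts *)

Section Charts.
Context {R : realType} {n : nat} {M : topologicalType} {A : smooth_atlas R n M}.
Implicit Types (i j : chart_index A) (x : M) (U : set M) (w : M -> R).

Lemma chartKx {i x} : chart_dom i x -> chart_inv i (chart i x) = x.
Proof. by move=> ix; apply: chartK; exact: mem_set. Qed.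

Lemma near_chart {i x} (P : set 'rV[R]_n) : chart_dom i x ->
  (\forall z \near chart i x, P z) -> \forall y \near x, P (chart i y).
Proof.
by move=> ix; have := @chart_continuous _ _ _ A i x (mem_set ix); apply.
Qed.

Lemma near_chart_inv {i x} U : chart_dom i x ->
  (\forall y \near x, U y) -> \forall z \near chart i x, U (chart_inv i z).
Proof.
move=> ix; have img : chart i x \in chart i @` chart_dom i.
  by apply: mem_set; exists x.
have := @chart_inv_continuous _ _ _ A i _ img.
by rewrite /continuous_at chartKx // => + xU; apply.
Qed.

Lemma near_chart_dom {i x} : chart_dom i x -> \forall y \near x, chart_dom i y.
Proof. by move=> ix; apply: open_nbhs_nbhs; split=> //; exact: chart_dom_open. Qed.

Lemma chart_invK_near {i x} : chart_dom i x ->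
  \forall z \near chart i x, chart_dom i (chart_inv i z) /\ chart i (chart_inv i z) = z.
Proof.
move=> ix; have : nbhs (chart i x) (chart i @` chart_dom i).
  by apply: open_nbhs_nbhs; split; [exact: chart_img_open|exists x].
by apply: filterS => z [y iy <-]; rewrite chartKx.
Qed.

Lemma chart_image_open i U : open U -> open (chart i @` (chart_dom i `&` U)).
Proof.
move=> oU; rewrite openE => z [x [ix Ux] <-].
have nU := near_chart_inv ix (open_nbhs_nbhs (conj oU Ux)).
apply: filterS2 nU (chart_invK_near ix) => y Uy [iy Ky].
by exists (chart_inv i y).
Qed.

Lemma transition_C1 i j :
  Ck_on 1 (chart i @` (chart_dom i `&` chart_dom j)) (chart j \o chart_inv i).
Proof. exact: (@transition_smooth _ _ _ A i j 1%N). Qed.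

Lemma transition_differentiable i j x : chart_dom i x -> chart_dom j x ->
  differentiable (chart j \o chart_inv i) (chart i x).
Proof.
move=> ix jx; apply: C1_differentiable_mx (transition_C1 i j) _.
  by apply: chart_image_open; exact: chart_dom_open.
by exists x.
Qed.

Lemma transition_jac_id i x : chart_dom i x -> transition_jac i i x = 1%:M.
Proof.
move=> ix; apply/row_matrixP => k; rewrite !rowE mulmx1.
rewrite -deriveEjacobian; last exact: transition_differentiable.
rewrite (@near_eq_derive _ _ _ _ id) ?derive_id //.
by apply: filterS (chart_invK_near ix) => z [_].
Qed.

Lemma covector_of_chart_at x q : covector_of_chart (chart_at A x) x q = q.
Proof.
by rewrite /covector_of_chart transition_jac_id ?mul1mx //; exact: chart_atP.
Qed.

Lemma C1_on_C1at U (phi : M -> R) i x : open U -> U x -> C1_on A U phi ->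
  chart_dom i x -> C1at (phi \o chart_inv i) (chart i x).
Proof.
move=> oU Ux phiC ix; exists (chart i @` (chart_dom i `&` U)); last exact: phiC.
by split; [exact: chart_image_open|exists x].
Qed.

(** The chain rule through the transition map from the preferred chart at x to
    chart i. *)
Lemma cotangent_diff_chart U (phi : M -> R) i x :
  open U -> U x -> C1_on A U phi -> chart_dom i x ->
  cotangent_diff A phi x =
  covector_of_chart i x (grad (phi \o chart_inv i) (chart i x)).
Proof.
move=> oU Ux phiC ix; set c := chart_at A x; have cx : chart_dom c x := chart_atP A x.
have -> : cotangent_diff A phi x = grad (phi \o chart_inv c) (chart c x) by [].
have Tx : (chart i \o chart_inv c) (chart c x) = chart i x by rewrite /= chartKx.
rewrite (@grad_near_eq _ _ _ ((phi \o chart_inv i) \o (chart i \o chart_inv c))); last first.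
  have := near_chart_inv cx (near_chart_dom ix).
  by apply: filterS => z iz /=; rewrite chartKx.
have oE : open (chart i @` (chart_dom i `&` U)) by exact: chart_image_open.
rewrite (grad_comp _ oE (phiC i)); first by rewrite Tx.
  exact: transition_differentiable.
by rewrite Tx; exists x.
Qed.

Lemma C1_on_chart i (D : set 'rV[R]_n) (f : 'rV[R]_n -> R) :
  open D -> Ck_on 1 D (f : _ -> R^o) ->
  open (chart_dom i `&` chart i @^-1` D) /\
  C1_on A (chart_dom i `&` chart i @^-1` D) (f \o chart i).
Proof.
move=> oD fC; set U := _ `&` _.
have oU : open U.
  rewrite openE => x [ix Dx]; apply: filterI; first exact: near_chart_dom.
  by apply: near_chart ix _; exact: open_nbhs_nbhs.
split; first exact: oU.
move=> j; have TC : Ck_on 1 (chart j @` (chart_dom j `&` U)) (chart i \o chart_inv j).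
  apply: C1_subset (transition_C1 j i) => _ [x [jx [ix _]] <-].
  by exists x.
apply: (@C1_comp _ _ _ _ D f (chart i \o chart_inv j) _ oD TC fC); first exact: chart_image_open.
by move=> _ [x [jx [ix Dx]] <-]; rewrite /= chartKx.
Qed.

Definition chart_supergrad w i x := supergrad (w \o chart_inv i) (chart i x).

(** Local C1 functions in any chart are test functions on M, so viscosity tests
    can be carried out in the chart of one's choice. *)
Lemma C1at_chart i x (f : 'rV[R]_n -> R) : chart_dom i x -> C1at f (chart i x) ->
  exists U, [/\ open U, U x, C1_on A U (f \o chart i) &
    cotangent_diff A (f \o chart i) x = covector_of_chart i x (grad f (chart i x))].
Proof.
move=> ix [D [oD Dx] fC]; have [oU UC] := C1_on_chart i oD fC.
exists (chart_dom i `&` chart i @^-1` D); split=> //.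
rewrite (cotangent_diff_chart oU _ UC ix) //; congr (covector_of_chart _ _ _).
by apply: grad_near_eq; apply: filterS (chart_invK_near ix) => z [_ /= ->].
Qed.

(** A linear function in the preferred chart has differential p at x; the
    coordinates of p in chart i are those of its gradient in that chart. *)
Lemma covector_of_chart_surj i x (p : 'cV[R]_n) : chart_dom i x ->
  exists q, p = covector_of_chart i x q.
Proof.
move=> ix; set c := chart_at A x; have cx : chart_dom c x := chart_atP A x.
have [fC fE] := C1at_linform p (chart c x).
have [U [oU Ux phiC dphi]] := C1at_chart cx fC.
rewrite fE covector_of_chart_at in dphi.
exists (grad (((fun z => (z *m p) 0 0) \o chart c) \o chart_inv i) (chart i x)).
by rewrite -[LHS]dphi; exact: cotangent_diff_chart oU Ux phiC ix.
Qed.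

Implicit Type H : M -> 'cV[R]_n -> R -> R.

Lemma subsolution_test H c w i x q : viscosity_subsolution A H c w ->
  chart_dom i x -> chart_supergrad w i x q ->
  H x (covector_of_chart i x q) (w x) <= c.
Proof.
move=> [_ wH] ix [f [fC wf <-]].
have [U [oU Ux phiC <-]] := C1at_chart ix fC.
apply: wH phiC _ => //; apply: filterS2 (near_chart ix wf) (near_chart_dom ix) => y + iy.
by rewrite /= !chartKx.
Qed.

Lemma test_chart_supergrad w U (phi : M -> R) i x :
  open U -> U x -> C1_on A U phi -> chart_dom i x ->
  (\forall y \near x, w y - phi y <= w x - phi x) ->
  chart_supergrad w i x (grad (phi \o chart_inv i) (chart i x)).
Proof.
move=> oU Ux phiC ix wphi; exists (phi \o chart_inv i); split=> //.
  exact: C1_on_C1at oU Ux phiC ix.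
by apply: filterS (near_chart_inv ix wphi) => z /=; rewrite chartKx.
Qed.

Lemma subsolution_intro H c w : continuous w ->
  (forall x, exists2 i : chart_index A, chart_dom i x & forall q,
    chart_supergrad w i x q -> H x (covector_of_chart i x q) (w x) <= c) ->
  viscosity_subsolution A H c w.
Proof.
move=> wc wH; split=> // x U phi oU Ux phiC wphi.
have [i ix {}wH] := wH x; rewrite (cotangent_diff_chart oU Ux phiC ix).
by apply: wH; exact: test_chart_supergrad oU Ux phiC ix wphi.
Qed.

(** Changing the sign of functions exchanges supersolutions of H and
    subsolutions of this Hamiltonian, which transfers stability from the latter
    to the former. *)
Definition dual_hamiltonian H x p u : R := - H x (- p) (- u).

Lemma C1_on_opp U (phi : M -> R) : open U -> C1_on A U phi ->
  C1_on A U (fun x => - phi x) /\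
  forall x, U x -> cotangent_diff A (fun x => - phi x) x = - cotangent_diff A phi x.
Proof.
move=> oU phiC; split=> [i|x Ux].
  by have [] := C1_oppr (@chart_image_open i U oU) (phiC i).
have cx := chart_atP A x.
exact: (C1at_opp (C1_on_C1at oU Ux phiC cx)).2.
Qed.

Lemma supersolutionP H c w : viscosity_supersolution A H c w <->
  viscosity_subsolution A (dual_hamiltonian H) (- c) (fun x => - w x).
Proof.
split=> -[wc wH].
- split=> [x|x U phi oU Ux phiC wphi]; first by apply: cvgN; exact: wc.
  rewrite /dual_hamiltonian opprK lerN2.
  have [NC NE] := C1_on_opp oU phiC.
  rewrite -NE //; apply: wH NC _ => //.
  by apply: filterS wphi => y; rewrite !opprK; lra.
- split=> [x|x U phi oU Ux phiC wphi].
    rewrite -[w]opprK; apply: (@cvgN _ _ _ (nbhs x)); exact: wc.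
  have [NC NE] := C1_on_opp oU phiC.
  have := wH x U _ oU Ux NC; rewrite /dual_hamiltonian NE // !opprK lerN2.
  by apply; apply: filterS wphi => y; lra.
Qed.

End Charts.

(** * Continuity and coercivity of the Hamiltonian *)

Section Hamiltonian.
Context {R : realType} {n : nat} {M : topologicalType} {A : smooth_atlas R n M}.
Implicit Types (i j : chart_index A) (x : M) (U : set M) (w : M -> R).
Implicit Type H : M -> 'cV[R]_n -> R -> R.

Lemma hamiltonian_near H i x (q : 'cV[R]_n) (u e : R) :
  hamiltonian_continuous A H -> chart_dom i x -> 0 < e ->
  exists2 d : R, 0 < d & \forall x' \near x, forall q' u',
    `|q' - q| < d -> `|u' - u| < d ->
    `|H x' (covector_of_chart i x' q') u' - H x (covector_of_chart i x q) u| < e.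
Proof.
move=> Hc ix e0.
have := Hc i (x, q, u) (mem_set ix).
move=> /(@nbhs_dist _ (M * 'cV[R]_n * R)%type R^o)/(_ e e0).
case=> -[V W] [[[V1 V2]] [V1x V2q] V12 Wu] VWP.
have /nbhs_ballP[d1 /= d10 d1P] := V2q.
have /nbhs_ballP[d2 /= d20 d2P] := Wu.
exists (Num.min d1 d2); first by rewrite lt_min d10.
apply: filterS V1x => x' V1x' q' u'; rewrite !lt_min => /andP[q1 _] /andP[_ u1].
rewrite distrC; apply: (VWP (x', q', u')); split; last first.
  by apply: d2P; rewrite -ball_normE /= distrC.
apply: V12; split=> //=; apply: d1P.
by rewrite -ball_normE /= distrC.
Qed.

Lemma covector_of_chartN i x q : covector_of_chart i x (- q) = - covector_of_chart i x q.
Proof. by rewrite /covector_of_chart mulmxN. Qed.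

Lemma covector_of_chart0 i x : covector_of_chart i x 0 = 0.
Proof. by rewrite /covector_of_chart mulmx0. Qed.

Lemma near_hamiltonian_continuous (F : M -> 'cV[R]_n -> R -> R) x (q : 'cV[R]_n) (u : R) :
  (forall e : R, 0 < e -> exists2 d : R, 0 < d & \forall x' \near x, forall q' u',
    `|q' - q| < d -> `|u' - u| < d -> `|F x' q' u' - F x q u| < e) ->
  {for (x, q, u), continuous (fun z : M * 'cV[R]_n * R => F z.1.1 z.1.2 z.2)}.
Proof.
move=> Fe; apply/(@cvg_nbhs_dist _ _ R^o) => e e0.
have [d d0 dP] := Fe e e0.
have nq := near_distC q d0.
have nu := @near_distC _ R^o u d d0.
exists ([set x' | forall q' u', `|q' - q| < d -> `|u' - u| < d ->
   `|F x' q' u' - F x q u| < e] `*` [set q' | `|q' - q| < d], [set u' | `|u' - u| < d]).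
  split; last exact: nu.
  exists ([set x' | forall q' u', `|q' - q| < d -> `|u' - u| < d ->
   `|F x' q' u' - F x q u| < e], [set q' | `|q' - q| < d]).
    by split; [exact: dP|exact: nq].
  by [].
by move=> [[x' q'] u'] /= [[h1 h2] h3]; rewrite distrC; exact: h1.
Qed.

Lemma dual_hamiltonian_continuous H :
  hamiltonian_continuous A H -> hamiltonian_continuous A (dual_hamiltonian H).
Proof.
move=> Hc i [[x q] u] /set_mem /= ix.
apply: (@near_hamiltonian_continuous (fun x q u =>
  dual_hamiltonian H x (covector_of_chart i x q) u)) => e e0.
have [d d0 dP] := hamiltonian_near (- q) (- u) Hc ix e0; exists d => //.
apply: filterS dP => x' h q' u' q'q u'u.
rewrite /dual_hamiltonian opprK addrC distrC -!covector_of_chartN.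
by apply: h; rewrite -opprD normrN.
Qed.

Lemma hamiltonian0_continuous H a : hamiltonian_continuous A H ->
  continuous (fun x => H x 0 a).
Proof.
move=> Hc x; apply: cvg_nbhs_dist => e e0; have ix := chart_atP A x.
have [d d0 dP] := hamiltonian_near 0 a Hc ix e0.
have q0 : `|(0 : 'cV[R]_n) - 0| < d by rewrite subr0 normr0.
have a0 : `|a - a| < d by rewrite subrr normr0.
apply: filterS dP => x' h; have := h 0 a q0 a0.
by rewrite !covector_of_chart0 distrC.
Qed.

Lemma compact_max (f : M -> R) : compact [set: M] -> [set: M] !=set0 -> continuous f ->
  exists x, forall y, f y <= f x.
Proof.
move=> cM M0 fc.
have [|x _ xP] := @compact_EVT_max _ _ f _ M0 cM.
  by apply: continuous_in_subspaceT => y _; exact: fc.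
by exists x => y; apply: xP; rewrite inE.
Qed.

Lemma compact_min (f : M -> R) : compact [set: M] -> [set: M] !=set0 -> continuous f ->
  exists x, forall y, f x <= f y.
Proof.
move=> cM M0 fc.
have [|x _ xP] := @compact_EVT_min _ _ f _ M0 cM.
  by apply: continuous_in_subspaceT => y _; exact: fc.
by exists x => y; apply: xP; rewrite inE.
Qed.

Lemma cV_ball_compact (r : R) : compact [set q : 'cV[R]_n | `|q| <= r].
Proof.
rewrite (_ : mkset _ = trmx @` [set z : 'rV[R]_n | `|z - 0| <= r]).
  apply: continuous_compact; last exact: closed_ball_compact.
  apply: continuous_subspaceT => z; exact: trmx_continuous.
apply/seteqP; split=> [q /= qr|_ [z /= zr <-] /=].
  by exists q^T; rewrite ?trmxK //= subr0 norm_trmx.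
by rewrite norm_trmx; rewrite subr0 in zr.
Qed.

Lemma cV_sphere_compact (r : R) : compact [set q : 'cV[R]_n | `|q| = r].
Proof.
apply: (subclosed_compact _ (cV_ball_compact (r := r))).
  rewrite (_ : mkset _ = (fun q : 'cV[R]_n => `|q|) @^-1` [set t | t = r]) //.
  apply: closed_comp; last exact: closed_eq.
  move=> q _; exact: (cvg_norm (@cvg_id _ (nbhs q))).
by move=> q /= ->.
Qed.

Lemma posdef_unitmx (G : 'M[R]_n) :
  (forall v : 'rV[R]_n, v != 0 -> 0 < (v *m G *m v^T) 0 0) -> G \in unitmx.
Proof.
move=> Gpos; rewrite -row_free_unit -kermx_eq0; apply/rowV0P => v /sub_kermxP vG.
by apply: contraTeq isT => /Gpos; rewrite vG mul0mx mxE ltxx.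
Qed.

(** The dual quadratic form is positive on the compact unit sphere. *)
Lemma covector_norm_lower (g : riemannian_metric A) x :
  exists2 k : R, 0 < k & forall p, k * `|p| <= covector_norm g x p.
Proof.
set G := metric g x; have Gpos := @metric_pos _ _ _ _ g x.
have uG : G \in unitmx := posdef_unitmx Gpos.
pose Q (p : 'cV[R]_n) : R := (p^T *m invmx G *m p) 0 0.
have Qpos p : p != 0 -> 0 < Q p.
  move=> p0; pose v := (invmx G *m p)^T.
  have pE : p = G *m v^T by rewrite trmxK mulKVmx.
  have v0 : v != 0.
    by apply: contra_neq p0 => v0; rewrite pE v0 trmx0 mulmx0.
  have := Gpos v v0; rewrite -/G; congr (0 < _).
  rewrite /Q -!mulmxA -pE /v trmx_mul trmx_inv (Defs.metric_sym g x) -mulmxA.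
  by rewrite mulmxA.
have Qc (p : 'cV[R]_n) : Q z @[z --> p] --> Q p.
  have H1 : z^T @[z --> p] --> p^T by exact: trmx_continuous.
  have H2 : (z^T *m invmx G) @[z --> p] --> p^T *m invmx G.
    by apply: (@cvg_mulmx _ _ (nbhs p)); [exact: H1|exact: cvg_cst].
  have H3 : (z^T *m invmx G *m z) @[z --> p] --> p^T *m invmx G *m p.
    by apply: (@cvg_mulmx _ _ (nbhs p)); [exact: H2|exact: cvg_id].
  exact: (cvg_coord H3).
have [[p0 p01]|S0] := pselect ([set q : 'cV[R]_n | `|q| = 1] !=set0); last first.
  exists 1 => // p; rewrite (_ : `|p| = 0) ?mulr0 ?sqrtr_ge0 //.
  apply/eqP; apply: contra_notT S0 => np; exists (`|p|^-1 *: p).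
  by rewrite /= normrZ ger0_norm ?invr_ge0 // mulVf.
have [|p1 p1S p1P] := @compact_EVT_min _ _ Q _ (ex_intro _ p0 p01) (cV_sphere_compact (r := 1)).
  by apply: continuous_in_subspaceT => p _; exact: Qc.
have {p1S} p11 : `|p1| = 1 by exact: set_mem.
have Q1 : 0 < Q p1 by apply: Qpos; rewrite -normr_eq0 p11 oner_eq0.
exists (Num.sqrt (Q p1)) => [|p]; first by rewrite sqrtr_gt0.
have [->|p_neq0] := eqVneq p 0; first by rewrite normr0 mulr0 sqrtr_ge0.
have np0 : 0 < `|p| by rewrite normr_gt0.
have pS : `|p|^-1 *: p \in [set q : 'cV[R]_n | `|q| = 1].
  by apply: mem_set; rewrite /= normrZ ger0_norm ?invr_ge0 // mulVf // gt_eqF.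
have QZ : Q p = `|p| ^+ 2 * Q (`|p|^-1 *: p).
  have trZ : (`|p|^-1 *: p)^T = `|p|^-1 *: p^T by apply/matrixP => i j; rewrite !mxE.
  rewrite /Q trZ -!scalemxAl -scalemxAr 2![in RHS]mxE; set c := (_ *m _) 0 0.
  by field; rewrite gt_eqF.
rewrite /covector_norm -/G -/(Q p) QZ mulrC sqrtrM ?sqr_ge0 // sqrtr_sqr normr_id.
by rewrite ler_wpM2l // ler_sqrt ?p1P // (le_trans (ltW Q1)) // p1P.
Qed.

End Hamiltonian.

Section Coercive.
Context {R : realType} {n : nat} {M : topologicalType} {A : smooth_atlas R n M}.
Implicit Types (i j : chart_index A) (x : M) (U : set M) (w : M -> R).
Implicit Type H : M -> 'cV[R]_n -> R -> R.

(** One chart around x0 measures the covectors at all nearby points, so that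
    the bound is uniform there. *)
Definition locally_coercive (F : M -> 'cV[R]_n -> R) := forall (C : R) x0,
  exists r : R, \forall x \near x0, forall q,
    F x (covector_of_chart (chart_at A x0) x q) <= C -> `|q| <= r.

Lemma superlinear_large (g : riemannian_metric A) H x a (C : R) :
  hamiltonian_superlinear g H -> exists2 r : R, 0 < r &
  forall p, r <= `|p| -> C < H x p a.
Proof.
move=> Hs; have [k k0 kP] := covector_norm_lower g x.
have [B BP] := Hs x a (`|C| + 1); set B' := Num.max B 1 + 1.
have B'1 : 1 < B' by rewrite ltrDr // lt_max ltr01 orbT.
have B'0 : 0 < B' := lt_trans ltr01 B'1.
exists (B' / k) => [|p]; first by rewrite divr_gt0.
rewrite ler_pdivrMr // mulrC => pB; have gB := le_trans pB (kP p).
have gp1 := lt_le_trans B'1 gB.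
have : B < covector_norm g x p.
  by apply: lt_le_trans gB; rewrite ltr_pwDr // le_max lexx.
move/BP; rewrite ltr_pdivlMr ?(lt_trans ltr01) //; apply: le_lt_trans.
apply: le_trans (ler_norm C) _; apply: (@le_trans _ _ (`|C| + 1)); first by rewrite lerDl.
by rewrite ler_peMr // ?addr_ge0 // ltW.
Qed.

(** Superlinearity is pointwise in x.  Over x0 it makes H large on some sphere
    of covectors; by compactness of the sphere H stays large on it over the nearby
    points, and convexity along the rays from the zero covector carries this
    lower bound to everything outside the sphere. *)
Lemma superlinear_locally_coercive (g : riemannian_metric A) H a :
  hamiltonian_continuous A H -> hamiltonian_convex H ->
  hamiltonian_superlinear g H -> locally_coercive (fun x p => H x p a).
Proof.
move=> Hc Hx Hs C x0; set i := chart_at A x0; have ix := chart_atP A x0.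
(* C0 also exceeds H at the zero covector, as convexity along rays requires *)
pose C0 := Num.max C (H x0 0 a + 1).
have [r r0 rP] := superlinear_large x0 a (C0 + 1) Hs.
have n0 : \forall x \near x0, H x 0 a < C0.
  have := nbhs_dist (@hamiltonian0_continuous _ _ _ A H a Hc x0) ltr01.
  apply: filterS => x; rewrite ltr_norml => /andP[h _].
  by rewrite /C0 lt_max; apply/orP; right; lra.
have nS : \forall x \near x0, [set q : 'cV[R]_n | `|q| = r] `<=`
    (fun q => C0 < H x (covector_of_chart i x q) a).
  have /compact_near_coveringP cS := @cV_sphere_compact R n r.
  apply: (cS _ (nbhs x0) (fun x q => C0 < H x (covector_of_chart i x q) a)).
  move=> q qr; have [d d0 dP] := hamiltonian_near q a Hc ix ltr01.
  have a0 : `|a - a| < d by rewrite subrr normr0.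
  exists ([set q' | `|q' - q| < d], [set x | forall q' u',
    `|q' - q| < d -> `|u' - a| < d ->
    `|H x (covector_of_chart i x q') u' - H x0 (covector_of_chart i x0 q) a| < 1]).
    by have nq := near_distC q d0; split; [exact: nq|exact: dP].
  move=> [q' x] /= [qd /(_ q' a qd a0)].
  have := rP q; rewrite qr lexx => /(_ isT).
  rewrite -{1}(@covector_of_chart_at _ _ _ A x0 q) -/i ltr_norml => h1 /andP[h2 _]; lra.
exists r; apply: filterS2 n0 nS => x h0 hS q Hq.
rewrite leNgt; apply/negP => rq; have q0 := lt_trans r0 rq.
pose t := r / `|q|.
have t01 : 0 <= t <= 1.
  by rewrite divr_ge0 ?(ltW r0) // ler_pdivrMr // mul1r ltW.
have := Hx x a (covector_of_chart i x q) 0 t t01.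
rewrite scaler0 addr0.
have -> : t *: covector_of_chart i x q = covector_of_chart i x (t *: q).
  by rewrite /covector_of_chart scalemxAr.
have : C0 < H x (covector_of_chart i x (t *: q)) a.
  apply: hS; rewrite /= normrZ ger0_norm; last by case/andP: t01.
  by rewrite /t divfK // gt_eqF.
have CC : C <= C0 by rewrite /C0 le_max lexx.
have {}Hq := le_trans Hq CC.
move: t01 h0 Hq; rewrite -/i; set h1 := H x 0 a; set h2 := H _ _ _; set h3 := H _ _ _.
move=> /andP[t0 t1] h10 h20 h30 h31.
have : t * h2 <= t * C0 by rewrite ler_wpM2l.
have : (1 - t) * h1 <= (1 - t) * C0 by rewrite ler_wpM2l ?subr_ge0 // ltW.
by rewrite mulrBl [in X in _ <= X]mulrBl !mul1r => *; lra.
Qed.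

(** The covectors concerned form a compact set over a neighbourhood of each
    point of the compact space M. *)
Lemma hamiltonian_uniform_in_u H a b0 (C e : R) :
  compact [set: M] -> hamiltonian_continuous A H ->
  locally_coercive (fun x p => H x p b0) -> 0 < e ->
  \forall b \near a, forall x p, H x p b0 <= C -> `|H x p b - H x p a| < e.
Proof.
move=> cM Hc Hco e0.
have /compact_near_coveringP cM' := cM.
have : \forall b \near a, [set: M] `<=`
    (fun x => forall p, H x p b0 <= C -> `|H x p b - H x p a| < e).
  apply: (cM' _ (nbhs a) (fun b x => forall p, H x p b0 <= C -> `|H x p b - H x p a| < e)).
  move=> x0 _; set i := chart_at A x0; have ix := chart_atP A x0.
  have [r rP] := Hco C x0.
  have /compact_near_coveringP cB := @cV_ball_compact R n r.
  have : \forall z \near (x0, a), [set q : 'cV[R]_n | `|q| <= r] `<=`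
     (fun q => `|H z.1 (covector_of_chart i z.1 q) z.2 -
                 H z.1 (covector_of_chart i z.1 q) a| < e).
    apply: (cB _ (nbhs (x0, a)) (fun z q => `|H z.1 (covector_of_chart i z.1 q) z.2 -
                 H z.1 (covector_of_chart i z.1 q) a| < e)).
    move=> q _; have e2 : 0 < e / 2 by rewrite divr_gt0.
    have [d d0 dP] := hamiltonian_near q a Hc ix e2.
    have a0 : `|a - a| < d by rewrite subrr normr0.
    exists ([set q' | `|q' - q| < d], [set x | forall q' u',
      `|q' - q| < d -> `|u' - a| < d ->
      `|H x (covector_of_chart i x q') u' - H x0 (covector_of_chart i x0 q) a| < e / 2]
       `*` [set b | `|b - a| < d]).
      split; first by have nq := near_distC q d0; exact: nq.
      exists ([set x | forall q' u',
        `|q' - q| < d -> `|u' - a| < d ->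
        `|H x (covector_of_chart i x q') u' - H x0 (covector_of_chart i x0 q) a| < e / 2],
        [set b | `|b - a| < d]) => //.
      by split; [exact: dP|exact: (@near_distC _ R^o a d d0)].
    move=> [q' [x b]] /= [qd [h bd]].
    have := h q' b qd bd; have := h q' a qd a0.
    by rewrite !ltr_norml => /andP[? ?] /andP[? ?]; apply/andP; split; lra.
  case=> -[V W] [Vx Wa] VWP.
  have nV : \forall x \near x0, [/\ chart_dom i x, V x &
     forall q, H x (covector_of_chart i x q) b0 <= C -> `|q| <= r].
    by apply: filterS3 (near_chart_dom ix) Vx rP.
  exists ([set x | [/\ chart_dom i x, V x &
     forall q, H x (covector_of_chart i x q) b0 <= C -> `|q| <= r]], W) => //.
  move=> [x b] /= [[jx Vx' xr] Wb] p.
  have [q ->] := covector_of_chart_surj p jx => /xr qr.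
  exact: (VWP (x, b) (conj Vx' Wb) q qr).
by apply: filterS => b h x p; exact: h.
Qed.

Lemma subsolution_cst H (k c : R) :
  (forall x, H x 0 k <= c) -> viscosity_subsolution A H c (fun=> k).
Proof.
move=> Hk; apply: subsolution_intro => [x|x]; first exact: cvg_cst.
exists (chart_at A x); first exact: chart_atP.
move=> q [f [fC kf <-]].
have [C1 G1] := C1at_cst k (chart (chart_at A x) x).
by rewrite -(grad_local_max C1 fC) ?G1 ?covector_of_chart0.
Qed.

Lemma supersolution_cst H (k c : R) :
  (forall x, c <= H x 0 k) -> viscosity_supersolution A H c (fun=> k).
Proof.
move=> Hk; apply/supersolutionP; apply: subsolution_cst => x.
by rewrite /dual_hamiltonian oppr0 opprK lerN2.
Qed.

(** A constant touches w from above at a maximum point. *)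
Lemma subsolution_test_cst H w x (c : R) : viscosity_subsolution A H c w ->
  (forall y, w y <= w x) -> H x 0 (w x) <= c.
Proof.
move=> wH wx; have cx := chart_atP A x.
have [C1 G1] := C1at_cst 0 (chart (chart_at A x) x).
rewrite -(@covector_of_chart_at _ _ _ A x 0); apply: subsolution_test wH cx _.
exists (fun=> 0); split=> //.
apply: (@filterE _ (nbhs (chart (chart_at A x) x))) => z.
by rewrite /= (chartKx (chart_atP A x)) !subr0.
Qed.

End Coercive.

(** * Families of subsolutions *)

Section Families.
Context {R : realType} {n : nat} {M : topologicalType} {A : smooth_atlas R n M}.
Implicit Types (i j : chart_index A) (x : M) (U : set M) (w : M -> R).
Implicit Type H : M -> 'cV[R]_n -> R -> R.

Lemma chart_ball i x0 U : chart_dom i x0 -> (\forall x \near x0, U x) ->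
  exists2 rho : R, 0 < rho & forall z, `|z - chart i x0| < rho ->
    [/\ chart_dom i (chart_inv i z), chart i (chart_inv i z) = z & U (chart_inv i z)].
Proof.
move=> ix xU.
have : \forall z \near chart i x0,
    [/\ chart_dom i (chart_inv i z), chart i (chart_inv i z) = z & U (chart_inv i z)].
  by apply: filterS2 (chart_invK_near ix) (near_chart_inv ix xU) => z [].
move=> /nbhs_ballP[rho rho0 rhoP]; exists rho => // z zx.
by apply: rhoP; rewrite -ball_normE /= distrC.
Qed.

Lemma chart_pullback_continuous i w z : continuous w ->
  chart_dom i (chart_inv i z) -> chart i (chart_inv i z) = z ->
  {for z, continuous (w \o chart_inv i)}.
Proof.
move=> wc iz zK; apply: continuous_comp; last exact: wc.
by apply: chart_inv_continuous; apply: mem_set; exists (chart_inv i z).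
Qed.

Lemma subsolution_le H G (c d : R) w : viscosity_subsolution A H c w ->
  (forall x p, H x p (w x) <= c -> G x p (w x) <= d) ->
  viscosity_subsolution A G d w.
Proof.
move=> [wc wH] HG; split=> // x U phi oU Ux phiC wphi.
by apply: HG; exact: wH phiC wphi.
Qed.

Lemma supersolution_le H G (c d : R) w : viscosity_supersolution A H c w ->
  (forall x p, c <= H x p (w x) -> d <= G x p (w x)) ->
  viscosity_supersolution A G d w.
Proof.
move=> [wc wH] HG; split=> // x U phi oU Ux phiC wphi.
by apply: HG; exact: wH phiC wphi.
Qed.

(** Coercivity bounds the test gradients of all these subsolutions at once, in
    the chart at x0. *)
Lemma subsolutions_equicontinuous (F : M -> 'cV[R]_n -> R) (C e : R) x0 :
  locally_coercive (A := A) F -> 0 < e ->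
  \forall x \near x0, forall w,
    viscosity_subsolution A (fun x p _ => F x p) C w -> `|w x - w x0| <= e.
Proof.
move=> Fco e0; set i := chart_at A x0; have ix := chart_atP A x0.
have [r rP] := Fco C x0; have [rho rho0 rhoP] := chart_ball ix rP.
set y0 := chart i x0.
have rho20 : 0 < rho / 2 by rewrite divr_gt0.
set s := (rho / 2) ^+ 2 / 2.
have s0 : 0 < s by rewrite divr_gt0 // exprn_gt0.
have sq0 : sqn (y0 - y0) = 0 by rewrite subrr sqn0.
have nsq := nbhs_dist (@sqn_continuous R n y0 y0) s0.
have L0 : 0 < slope (n := n) r by rewrite mulr_gt0 // ltr_wpDl.
have eL0 : 0 < e / slope (n := n) r by rewrite divr_gt0.
have nsqrt : \forall z \near y0, Num.sqrt (sqn (z - y0)) < e / slope (n := n) r.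
  have h := continuous_comp (@sqn_continuous R n y0 y0) (@sqrt_continuous R _).
  have := nbhs_dist h eL0; apply: filterS => z; rewrite /= sq0 sqrtr0 sub0r normrN.
  by rewrite ger0_norm ?sqrtr_ge0.
have nd := near_distC y0 rho20.
have nz : \forall z \near y0, [/\ `|sqn (y0 - y0) - sqn (z - y0)| < s,
    Num.sqrt (sqn (z - y0)) < e / slope (n := n) r & `|z - y0| < rho / 2].
  by apply: filterS3 nsq nsqrt nd => z ? ? ?; split.
apply: filterS2 (near_chart ix nz) (near_chart_dom ix) => x [].
rewrite sq0 sub0r normrN ger0_norm ?sqn_ge0 // => sqx sqrtx dx jx w wF.
have [wc _] := wF.
have lip := @supergrad_bound_lipschitz R n (w \o chart_inv i) y0 rho r rho0.
have {}lip := lip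
  (fun z zy => chart_pullback_continuous wc (let: And3 a _ _ := rhoP z zy in a)
    (let: And3 _ b _ := rhoP z zy in b)).
have {}lip : forall y1 y2, `|y1 - y0| < rho / 2 -> sqn (y2 - y1) < s ->
  w (chart_inv i y2) - w (chart_inv i y1) <= slope (n := n) r * Num.sqrt (sqn (y2 - y1)).
  apply: lip => z q zy wq; have [iz zK] := rhoP z zy; apply.
  apply: (subsolution_test wF iz).
  by rewrite /chart_supergrad zK.
have sqC (y z : 'rV[R]_n) : sqn (y - z) = sqn (z - y).
  by apply: eq_bigr => k _; rewrite !mxE -sqrrN opprB.
have up : slope (n := n) r * Num.sqrt (sqn (chart i x - y0)) <= e.
  by rewrite mulrC -ler_pdivlMr // ltW.
have yy : `|y0 - y0| < rho / 2 by rewrite subrr normr0.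
have := lip y0 (chart i x) yy sqx; rewrite /y0 !chartKx // -/y0 => l1.
have := lip (chart i x) y0 dx; rewrite sqC => /(_ sqx); rewrite /y0 !chartKx // -/y0 => l2.
rewrite ler_norml; apply/andP; split.
  by have := le_trans l2 up; lra.
exact: le_trans l1 up.
Qed.

(** By equicontinuity, the points at which all subsolutions of level C stay
    within a common distance of their value at z0 form an open and closed set;
    compactness then makes this distance uniform. *)
Lemma subsolutions_bounded_osc (F : M -> 'cV[R]_n -> R) (C : R) :
  closed_connected M -> locally_coercive (A := A) F ->
  exists K : R, forall w, viscosity_subsolution A (fun x p _ => F x p) C w ->
    forall x y, w x - w y <= K.
Proof.
move=> [_ cM conM [z0 _]] Fco.
pose S := [set x | exists K : R, forall w,
  viscosity_subsolution A (fun x p _ => F x p) C w -> `|w x - w z0| <= K].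
have eqc x0 := @subsolutions_equicontinuous F C 1 x0 Fco ltr01.
have oS : open S.
  rewrite openE => x [K KP]; apply: filterS (eqc x) => y yx; exists (1 + K) => w wF.
  have := ler_normD (w y - w x) (w x - w z0); rewrite addrA subrK => h.
  by apply: le_trans h _; rewrite lerD // ?yx // KP.
have cS : closed S.
  move=> x clS; have [y [[K KP] yx]] := clS _ (eqc x); exists (1 + K) => w wF.
  have := ler_normD (w x - w y) (w y - w z0); rewrite addrA subrK => h.
  by apply: le_trans h _; rewrite lerD // ?KP // distrC yx.
have ST : S = [set: M].
  apply: conM.
  - by exists z0, 0 => w _; rewrite subrr normr0.
  - by exists S => //; rewrite setTI.
  - by exists S => //; rewrite setTI.
have /compact_near_coveringP cM' := cM.
have : \forall K \near +oo, [set: M] `<=` (fun x => forall w,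
  viscosity_subsolution A (fun x p _ => F x p) C w -> `|w x - w z0| <= K).
  apply: (cM' _ +oo (fun K x => forall w,
    viscosity_subsolution A (fun x p _ => F x p) C w -> `|w x - w z0| <= K)).
  move=> x _; have [K KP] : S x by rewrite ST.
  exists ([set y | forall w, viscosity_subsolution A (fun x p _ => F x p) C w ->
    `|w y - w x| <= 1], [set L | 1 + K <= L]).
    by split; [exact: eqc|exact: nbhs_pinfty_ge (num_real _)].
  move=> [y L] /= [yx KL] w wF.
  have := ler_normD (w y - w x) (w x - w z0); rewrite addrA subrK => h.
  by apply: le_trans h _; apply: le_trans KL; rewrite lerD // ?yx // KP.
move=> /filter_ex[K KP]; exists (K + K) => w wF x y.
have := KP x I w wF; have := KP y I w wF.
by rewrite !ler_norml => /andP[? ?] /andP[? ?]; lra.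
Qed.

(** Covers both suprema of subsolutions and uniform limits along levels
    tending to c. *)
Lemma subsolution_stable H (c : R) w :
  hamiltonian_continuous A H -> continuous w ->
  (forall x (d : R), 0 < d -> exists w', [/\ viscosity_subsolution A H (c + d) w',
     forall y, w' y <= w y + d & w x - d <= w' x]) ->
  viscosity_subsolution A H c w.
Proof.
move=> Hc wc wP; apply: subsolution_intro => // x0.
exists (chart_at A x0); first exact: chart_atP.
set i := chart_at A x0; have ix := chart_atP A x0.
move=> q wq; rewrite leNgt; apply/negP => cH.
set h0 := H x0 _ _ in cH; pose e := (h0 - c) / 2.
have e0 : 0 < e by rewrite divr_gt0 // subr_gt0.
have [d d0 dP] := hamiltonian_near q (w x0) Hc ix e0.
have [rho rho0 rhoP] := chart_ball ix dP.
set y0 := chart i x0 in rhoP.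
pose s := Num.min d rho; have s0 : 0 < s by rewrite lt_min d0.
have y0K : chart_inv i y0 = x0 by rewrite /y0 chartKx.
have srho : s <= rho by rewrite ge_min lexx orbT.
have sd : s <= d by rewrite ge_min lexx.
have wc0 : {for y0, continuous (w \o chart_inv i)}.
  by apply: chart_pullback_continuous => //; rewrite y0K.
have [t t0 tP] := supergrad_stable s0 wc0 wq.
pose t' := Num.min t e; have t'0 : 0 < t' by rewrite lt_min t0.
have t't : t' <= t by rewrite ge_min lexx.
have t'e : t' <= e by rewrite ge_min lexx orbT.
have [w' [w'H w'w w'x]] := wP x0 t' t'0; have [w'c _] := w'H.
have [||| y [q' [yy qq ww w'q]]] := tP (w' \o chart_inv i).
- move=> z zs; have [iz zK _] := rhoP z (lt_le_trans zs srho).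
  exact: chart_pullback_continuous.
- by move=> z _; apply: le_trans (w'w _) _; rewrite lerD2l.
- by rewrite /= y0K; apply: le_trans w'x; rewrite lerD2l lerN2.
have [iy yK yH] := rhoP y (lt_le_trans yy srho).
have := subsolution_test w'H iy (q := q'); rewrite /chart_supergrad yK => /(_ w'q) h1.
rewrite /= y0K in ww.
have := yH q' (w' (chart_inv i y)) (lt_le_trans qq sd) (lt_le_trans ww sd).
rewrite -/h0 ltr_norml => /andP[h2 _].
rewrite ltrBrDl in h2; have := lt_le_trans h2 h1.
have : h0 - c = e + e by rewrite /e; lra.
by move=> *; lra.

Qed.

End Families.

(** * Perron's method *)

Section Perron.
Context {R : realType} {n : nat} {M : topologicalType} {A : smooth_atlas R n M}.
Implicit Types (i j : chart_index A) (x : M) (U : set M) (w : M -> R).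
Implicit Type H : M -> 'cV[R]_n -> R -> R.

(** If a test function touching u from below at x0 is strictly below level c,
    then so are its translates and small perturbations near x0.  Raised by
    delta and bent down by the squared distance to x0, it exceeds u only very
    close to x0, and v is the maximum of the two. *)
Lemma subsolution_bump H (c : R) u w2 x0 U phi :
  hausdorff_space M -> hamiltonian_continuous A H ->
  viscosity_subsolution A H c u -> continuous w2 -> (forall y, u y <= w2 y) ->
  u x0 < w2 x0 ->
  open U -> U x0 -> C1_on A U phi ->
  (\forall y \near x0, u x0 - phi x0 <= u y - phi y) ->
  H x0 (cotangent_diff A phi x0) (u x0) < c ->
  exists v, [/\ viscosity_subsolution A H c v, forall y, u y <= v y,
    forall y, v y <= w2 y & u x0 < v x0].
Proof.
move=> hM Hc uH w2c uw2 uw2x0 oU Ux0 phiC uphi.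
set i := chart_at A x0; have ix := chart_atP A x0; rewrite -/i in ix.
rewrite (cotangent_diff_chart oU Ux0 phiC ix).
pose f := phi \o chart_inv i; set y0 := chart i x0; rewrite -/f.
have fC : C1at f y0 by exact: C1_on_C1at oU Ux0 phiC ix.
set q := grad f y0 => Hlt.
have y0K : chart_inv i y0 = x0 by rewrite /y0 chartKx.
have [uc _] := uH.
set e := c - H x0 (covector_of_chart i x0 q) (u x0).
have e0 : 0 < e by rewrite subr_gt0.
have [d d0 dP] := hamiltonian_near q (u x0) Hc ix e0.
pose eta := (w2 x0 - u x0) / 2.
have eta0 : 0 < eta by rewrite divr_gt0 // subr_gt0.
have nw2 : \forall y \near x0, u x0 + eta < w2 y.
  have := nbhs_dist (w2c x0) eta0; apply: filterS => y; rewrite ltr_norml => /andP[_].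
  have : w2 x0 - u x0 = eta + eta by rewrite /eta; lra.
  by move=> *; lra.
have n3 : \forall y \near x0, [/\ forall q' u', `|q' - q| < d -> `|u' - u x0| < d ->
     `|H y (covector_of_chart i y q') u' - H x0 (covector_of_chart i x0 q) (u x0)| < e,
     u x0 + eta < w2 y & u x0 - phi x0 <= u y - phi y].
  by apply: filterS3 dP nw2 uphi => y ? ? ?; split.
have [rho1 rho10 rho1P] := chart_ball ix n3.
pose m := Num.min d eta; have m0 : 0 < m by rewrite lt_min d0.
have md : m <= d by rewrite ge_min lexx.
have meta : m <= eta by rewrite ge_min lexx orbT.
have m2 : 0 < m / 2 by rewrite divr_gt0.
have [_ fc gc nC] := C1atP fC.
have nf := nbhs_dist fc m2.
have ng := nbhs_dist gc m2.
have /nbhs_ballP[rho2 /= rho20 rho2P] : \forall z \near y0,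
   [/\ C1at f z, `|f y0 - f z| < m / 2 & `|q - grad f z| < m / 2].
  by apply: filterS3 nC nf ng => z ? ? ?; split.
pose s := Num.min (Num.min rho1 rho2) (m / 8).
have s0 : 0 < s by rewrite !lt_min rho10 rho20 divr_gt0.
have srho1 : s <= rho1 by rewrite !ge_min lexx.
have srho2 : s <= rho2 by rewrite !ge_min lexx orbT.
have sm : s <= m / 8 by rewrite ge_min lexx orbT.
pose delta := Num.min (s ^+ 2 / 4) (m / 4).
have delta0 : 0 < delta by rewrite lt_min !divr_gt0 // exprn_gt0.
have deltas : delta <= s ^+ 2 / 4 by rewrite ge_min lexx.
have deltam : delta <= m / 4 by rewrite ge_min lexx orbT.
pose b z := u x0 - f y0 + delta + (f z - sqn (z - y0)).
have Pz z : `|z - y0| < s -> [/\ chart_dom i (chart_inv i z),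
     chart i (chart_inv i z) = z, u x0 + eta < w2 (chart_inv i z),
     u x0 - f y0 <= u (chart_inv i z) - f z & C1at f z].
  move=> zs; have [iz zK [_ ? uz]] := rho1P z (lt_le_trans zs srho1).
  have [? _ _] : [/\ C1at f z, `|f y0 - f z| < m / 2 & `|q - grad f z| < m / 2].
    by apply: rho2P; rewrite -ball_normE /= distrC (lt_le_trans zs).
  by split=> //; rewrite /f /= y0K.
have Pz' z : `|z - y0| < s -> `|f y0 - f z| < m / 2 /\ `|q - grad f z| < m / 2.
  move=> zs; have [] // : [/\ C1at f z, `|f y0 - f z| < m / 2 & `|q - grad f z| < m / 2].
  by apply: rho2P; rewrite -ball_normE /= distrC (lt_le_trans zs).
have PH z q' u' : `|z - y0| < s -> `|q' - q| < d -> `|u' - u x0| < d ->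
    H (chart_inv i z) (covector_of_chart i (chart_inv i z) q') u' <= c.
  move=> zs qd ud; have [_ _ [h _ _]] := rho1P z (lt_le_trans zs srho1).
  have := h q' u' qd ud; rewrite ltr_norml => /andP[_]; rewrite /e => h1; apply: ltW.
  by rewrite ltrBlDr subrK in h1.
pose B := [set y | chart_dom i y /\ `|chart i y - y0| < s].
pose v y := if `[< B y >] then Num.max (u y) (b (chart i y)) else u y.
have vB y : B y -> v y = Num.max (u y) (b (chart i y)).
  by move=> By; rewrite /v; case: asboolP.
have uv y : u y <= v y.
  by rewrite /v; case: asboolP => // _; rewrite le_max lexx.
(* contact with u is lost only where the squared distance is below delta *)
have vu y : v y <> u y -> [/\ B y, v y = b (chart i y), u y < b (chart i y) &
    sqn (chart i y - y0) < delta].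
  rewrite /v; case: asboolP => // By; have [iy ys] := By.
  have [ub|ub'] := leP (b (chart i y)) (u y); first by [].
  move=> _.
  split=> //; have [_ _ _ + _] := Pz _ ys; rewrite chartKx //.
  by move: ub'; rewrite /b => ? ?; lra.
have oB : open B.
  rewrite openE => y [iy ys]; apply: filterI; first exact: near_chart_dom.
  have ys' : 0 < s - `|chart i y - y0| by rewrite subr_gt0.
  have ns : \forall z \near chart i y, `|z - y0| < s.
    apply: filterS (near_distC (chart i y) ys') => z zy.
    have := ler_normD (z - chart i y) (chart i y - y0); rewrite addrA subrK.
    by move=> h; apply: le_lt_trans h _; rewrite -ltrBrDr.
  exact: near_chart iy ns.
have bC z : `|z - y0| < s -> C1at b z /\ grad b z = grad f z - 2 *: (z - y0)^T.
  move=> zs; have [_ _ _ _ fCz] := Pz z zs.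
  have [sC sG] := @C1_sqn R n y0 setT openT.
  have sCz : C1at (fun z => sqn (z - y0)) z by exists setT => //; split=> //; exact: openT.
  have [nC' nG'] := C1at_opp sCz.
  have [aC aG] := C1at_add fCz nC'.
  have [kC kG] := C1at_cst (u x0 - f y0 + delta) z.
  have [bC bG] := C1at_add kC aC.
  by split; [exact: bC|rewrite [LHS]bG kG add0r aG nG' sG].
(* v = u outside the compact set K, which is closed by separation; this gives
   the continuity of v at the points outside B *)
pose K := chart_inv i @` [set z | `|z - y0| <= s / 2].
have s2 : s / 2 < s by rewrite ltr_pdivrMr // ltr_pMr // ltr1n.
have cK : compact K.
  apply: continuous_compact; last exact: closed_ball_compact.
  apply: continuous_in_subspaceT => z /set_mem /= zs.
  have [iz zK _ _ _] := Pz z (le_lt_trans zs s2).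
  by apply: chart_inv_continuous; apply: mem_set; exists (chart_inv i z).
have oK : open (~` K) by apply: closed_openC; exact: compact_closed.
have KB : K `<=` B.
  move=> _ [z /= zs <-]; have [iz zK _ _ _] := Pz z (le_lt_trans zs s2).
  by split=> //; rewrite zK; exact: le_lt_trans s2.
have vuK y : ~ K y -> v y = u y.
  move=> nKy; apply: contra_notP nKy => /vu[[iy ys] _ _ sq].
  exists (chart i y); last exact: chartKx.
  rewrite /= -ler_sqr ?nnegrE // ?divr_ge0 // ?(ltW s0) //.
  apply: le_trans (normr_sqr_le_sqn _) _; apply: le_trans (ltW sq) _.
  by rewrite expr_div_n; apply: le_trans deltas _; rewrite -natrX.
have vc : continuous v.
  move=> y; have [By|nBy] := pselect (B y); last first.
    have nKy : ~ K y by move=> /KB.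
    have E : \forall z \near y, u z = v z.
      by apply: filterS (open_nbhs_nbhs (conj oK nKy)) => z /vuK.
    rewrite /continuous_at vuK //.
    exact: near_eq_cvg_at E (uc y).
  have E : \forall z \near y, Num.max (u z) (b (chart i z)) = v z.
    by apply: filterS (open_nbhs_nbhs (conj oB By)) => z /vB.
  rewrite /continuous_at vB //; apply: near_eq_cvg_at E _.
  have [iy ys] := By; have [/C1atP[_ bc _ _] _] := bC _ ys.
  have chc := @chart_continuous _ _ _ A i y (mem_set iy).
  exact: (continuous_max (uc y) (continuous_comp chc bc)).
exists v; split=> //; last first.
- have Bx0 : B x0 by split=> //; rewrite subrr normr0.
  rewrite vB // lt_max; apply/orP; right; rewrite /b -/y0 subrr sqn0.
  by lra.
- move=> y; have [->//|/eqP/vu[[iy ys] -> _ sq]] := eqVneq (v y) (u y).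
  have [_ _ w2y _ _] := Pz _ ys; rewrite chartKx // in w2y.
  have [fy _] := Pz' _ ys; move: fy; rewrite ltr_norml => /andP[fy _].
  have := sqn_ge0 (chart i y - y0); rewrite /b; lra.
- split=> // y V psi oV Vy psiC vpsi.
  have [vuy|/eqP/vu[By vb ub sq]] := eqVneq (v y) (u y).
    rewrite vuy; have [_ uH'] := uH; apply: (uH' y V psi) => //.
    apply: filterS vpsi => z h; rewrite -vuy; apply: le_trans h.
    by rewrite lerD2r.
  have [iy ys] := By; have [bCy bG] := bC _ ys.
  rewrite (cotangent_diff_chart oV Vy psiC iy).
  have psiC' := C1_on_C1at oV Vy psiC iy.
  rewrite -(grad_local_max bCy psiC'); last first.
    have h : \forall z \near y, B z /\ v z - psi z <= v y - psi y.
      exact: filterI (open_nbhs_nbhs (conj oB By)) vpsi.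
    have h' := near_chart_inv iy h.
    apply: filterS2 h' (chart_invK_near iy) => z [Bz vz] [iz zK].
    rewrite /= chartKx // -vb; apply: le_trans vz; rewrite lerD2r.
    by rewrite vB // zK le_max lexx orbT.
  have [fy gy] := Pz' _ ys.
  have := PH (chart i y) (grad b (chart i y)) (v y) ys; rewrite chartKx //; apply.
    rewrite bG addrAC -[grad f _ - q]opprB -opprD normrN.
    apply: le_lt_trans (ler_normD _ _) _; rewrite normrZ norm_trmx ger0_norm //.
    by move: gy ys sm md; lra.
  rewrite vb /b; move: fy sq deltam md; have := sqn_ge0 (chart i y - y0).
  by rewrite !ltr_norml => ? /andP[? ?] *; apply/andP; split; lra.
Qed.

(** The supremum u of the subsolutions between w1 and w2 is the solution.  At a
    point where u = w2 it inherits the supersolution test from w2; where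
    u < w2, a failed test would allow a larger subsolution by
    [subsolution_bump]. *)
Lemma perron H (c : R) w1 w2 :
  closed_connected M -> hamiltonian_continuous A H -> hamiltonian_nondecreasing H ->
  (forall a, locally_coercive (A := A) (fun x p => H x p a)) ->
  viscosity_subsolution A H c w1 -> viscosity_supersolution A H c w2 ->
  (forall x, w1 x <= w2 x) ->
  exists u, [/\ viscosity_solution A H c u, forall x, w1 x <= u x &
    forall x, u x <= w2 x].
Proof.
move=> [hM cM _ M0] Hc Hnd Hco w1H w2H w12.
have [w1c _] := w1H; have [w2c w2H'] := w2H.
pose S := [set w : M -> R | viscosity_subsolution A H c w /\
  forall x, w1 x <= w x <= w2 x].
pose u x := sup [set w x | w in S].
have S1 : S w1 by split=> // x; rewrite lexx w12.
have hs x : has_sup [set w x | w in S].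
  split; first by exists (w1 x), w1.
  by exists (w2 x) => _ [w [_ /(_ x)/andP[_ h]] <-].
have wu w x : S w -> w x <= u x.
  by move=> Sw; apply: sup_upper_bound => //; exists w.
have uw2 x : u x <= w2 x.
  apply: ge_sup; first by exists (w1 x), w1.
  by move=> _ [w [_ /(_ x)/andP[_ h]] <-].
have [xm xmP] := compact_min cM M0 w1c.
have Sm w : S w -> viscosity_subsolution A (fun x p _ => H x p (w1 xm)) c w.
  move=> [wH ww]; apply: subsolution_le wH _ => x p; apply: le_trans.
  apply: Hnd; apply: le_trans (xmP x) _; by case/andP: (ww x).
have uc : continuous u.
  move=> x; apply: cvg_nbhs_dist => e e0.
  have e2 : 0 < e / 2 by rewrite divr_gt0.
  have := @subsolutions_equicontinuous _ _ _ _ _ c _ x (Hco (w1 xm)) e2.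
  apply: filterS => y yx; rewrite -/(u y); apply: (@le_lt_trans _ _ (e / 2)); last by lra.
  rewrite ler_norml; apply/andP; split.
    suff h : u y <= u x + e / 2 by lra.
    apply: ge_sup; first by exists (w1 y), w1.
    move=> _ [w Sw <-]; have := yx w (Sm w Sw); rewrite ler_norml => /andP[_].
    by have := wu w x Sw; lra.
  suff h : u x <= u y + e / 2 by lra.
  apply: ge_sup; first by exists (w1 x), w1.
  move=> _ [w Sw <-]; have := yx w (Sm w Sw); rewrite ler_norml => /andP[+ _].
  by have := wu w y Sw; lra.
have uH : viscosity_subsolution A H c u.
  apply: subsolution_stable => // x d d0.
  have [_ [w Sw <-] wx] := sup_adherent d0 (hs x).
  exists w; split; last exact: ltW.
  - have [wH _] := Sw; apply: subsolution_le wH _ => y p h.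
    by apply: le_trans h _; rewrite lerDl ltW.
  - by move=> y; apply: le_trans (wu w y Sw) _; rewrite lerDl ltW.
exists u; split=> [|x|//]; last exact: wu.
split=> //; split=> // x0 U phi oU Ux phiC uphi.
rewrite leNgt; apply/negP => Hlt.
have [ueq|une] := eqVneq (u x0) (w2 x0).
  have := w2H' x0 U phi oU Ux phiC; rewrite -ueq leNgt Hlt => /(_ _)/negP; apply=> //.
  apply: filterS uphi => y h; apply: le_trans h _; by rewrite lerD2r.
have ult : u x0 < w2 x0 by rewrite lt_neqAle une uw2.
have [v [vH uv vw2 uvx]] := subsolution_bump hM Hc uH w2c uw2 ult oU Ux phiC uphi Hlt.
have Sv : S v.
  split=> // x; rewrite vw2 andbT; apply: le_trans (uv x); exact: wu.
by have := wu v x0 Sv; rewrite leNgt uvx.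
Qed.

End Perron.

(** * Uniform limits of equicontinuous sequences *)

Section ArzelaAscoli.
Context {R : realType} {M : topologicalType}.

Lemma ultra_bounded_cvg (F : set_system nat) (f : nat -> R) (B : R) :
  UltraFilter F -> (forall k, `|f k| <= B) ->
  exists l : R, forall e, 0 < e -> F [set k | `|f k - l| < e].
Proof.
move=> FU fB.
have cB : compact `[- B, B] := @segment_compact R (- B) B.
have FI : F (f @^-1` `[- B, B]).
  by apply: (@filterE _ F) => k; have := fB k; rewrite ler_norml /= in_itv.
have [l [_ lF]] := cB (f @ F) _ FI.
exists l => e e0; have [//|Fn] := in_ultra_setVsetC [set k | `|f k - l| < e] FU.
have [t [tF tl]] := lF [set t | ~ `|t - l| < e] _ Fn (@near_distC _ R^o l e e0).
by [].
Qed.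

(** The Arzela-Ascoli theorem.  Compactness alone gives no countable dense
    subset for a diagonal extraction; pointwise limits along an ultrafilter
    exist all the same, and equicontinuity with compactness makes the
    convergence uniform. *)
Lemma equicontinuous_subsequence_limit (v : nat -> M -> R) (B : R) :
  compact [set: M] ->
  (forall x (e : R), 0 < e -> \forall y \near x, forall k, `|v k y - v k x| <= e) ->
  (forall k x, `|v k x| <= B) ->
  exists2 w, continuous w & forall (e : R) N, 0 < e ->
    exists2 k, (N <= k)%N & forall x, `|v k x - w x| <= e.
Proof.
move=> cM veq vB.
have [F [FU ooF]] := @ultraFilterLemma nat \oo _.
have /choice[w wP] : forall x, exists l : R, forall e, 0 < e -> F [set k | `|v k x - l| < e].
  by move=> x; apply: ultra_bounded_cvg FU (fun k => vB k x).
have weq x (e : R) : 0 < e -> \forall y \near x, `|w y - w x| <= e.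
  move=> e0; have e3 : 0 < e / 3 by rewrite divr_gt0.
  apply: filterS (veq x _ e3) => y yx.
  have [k [/= ky kx]] := filter_ex (filterI (wP y _ e3) (wP x _ e3)).
  move: ky kx (yx k); rewrite !ltr_norml !ler_norml.
  by move=> /andP[? ?] /andP[? ?] /andP[? ?]; apply/andP; split; lra.
exists w.
  move=> x; apply: cvg_nbhs_dist => e e0; have e2 : 0 < e / 2 by rewrite divr_gt0.
  apply: filterS (weq x _ e2) => y; rewrite distrC => /le_lt_trans; apply.
  by rewrite ltr_pdivrMr // ltr_pMr // ltr1n.
move=> e N e0; have e3 : 0 < e / 3 by rewrite divr_gt0.
have /compact_near_coveringP cM' := cM.
have Fe : F [set k | [set: M] `<=` (fun x => `|v k x - w x| <= e)].
  apply: (cM' _ F (fun k x => `|v k x - w x| <= e)) => x _.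
  exists ([set y | (forall k, `|v k y - v k x| <= e / 3) /\ `|w y - w x| <= e / 3],
          [set k | `|v k x - w x| < e / 3]).
    by split; [exact: filterI (veq x _ e3) (weq x _ e3)|exact: wP].
  move=> [y k] /= [[/(_ k) + +]]; rewrite !ltr_norml !ler_norml.
  by move=> /andP[? ?] /andP[? ?] /andP[? ?]; apply/andP; split; lra.
have FN : F [set k | (N <= k)%N] by apply: ooF; exists N.
have [k [/= ke kN]] := filter_ex (filterI Fe FN).
by exists k => // x; exact: ke.
Qed.

End ArzelaAscoli.

(** * The ergodic constant *)

Section Ergodic.
Context {R : realType} {n : nat} {M : topologicalType} {A : smooth_atlas R n M}.
Implicit Types (i j : chart_index A) (x : M) (U : set M) (w : M -> R).
Implicit Type H : M -> 'cV[R]_n -> R -> R.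

(** H(., ., a) as a Hamiltonian that ignores the value of the function, the
    form under which [ergodic_constant] uses it. *)
Definition frozen H (a : R) : M -> 'cV[R]_n -> R -> R := fun x p _ => H x p a.

Lemma frozen_addr_continuous H a (k : R -> R) :
  hamiltonian_continuous A H -> continuous k ->
  hamiltonian_continuous A (fun x p u => H x p a + k u).
Proof.
move=> Hc kc i [[x q] u] /set_mem /= ix.
apply: (@near_hamiltonian_continuous _ _ _ (fun x q u =>
  H x (covector_of_chart i x q) a + k u)) => e e0.
have e2 : 0 < e / 2 by rewrite divr_gt0.
have [d d0 dP] := hamiltonian_near q a Hc ix e2.
have /nbhs_ballP[r /= r0 rP] := nbhs_dist (kc u) e2.
exists (Num.min d r); first by rewrite lt_min d0.
have aa : `|a - a| < d by rewrite subrr normr0.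
apply: filterS dP => x' h q' u'; rewrite !lt_min => /andP[qd _] /andP[_ ur].
have h1 := h q' a qd aa.
have h2 : `|k u - k u'| < e / 2 by apply: rP; rewrite -ball_normE /= distrC.
move: h1 h2; rewrite !ltr_norml => /andP[? ?] /andP[? ?]; apply/andP; split; lra.
Qed.

Lemma frozen_continuous H a :
  hamiltonian_continuous A H -> hamiltonian_continuous A (frozen H a).
Proof.
move=> Hc; rewrite (_ : frozen H a = fun x p u => H x p a + (fun=> 0) u); last first.
  by apply/funext => x; apply/funext => p; apply/funext => u; rewrite addr0.
by apply: frozen_addr_continuous => // u; exact: cvg_cst.
Qed.

Lemma frozen_subsolution_shift H a (c k : R) w :
  viscosity_subsolution A (frozen H a) c w ->
  viscosity_subsolution A (frozen H a) c (fun x => w x + k).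
Proof.
move=> [wc wH]; split=> [x|x U phi oU Ux phiC wphi].
  exact: (cvgD (wc x) (@cvg_cst _ (k : R^o) _ (nbhs x) _)).
by apply: wH phiC _ => //; apply: filterS wphi => y; rewrite !(addrAC _ k) lerD2r.
Qed.

Lemma frozen_supersolution_shift H a (c k : R) w :
  viscosity_supersolution A (frozen H a) c w ->
  viscosity_supersolution A (frozen H a) c (fun x => w x + k).
Proof.
move=> [wc wH]; split=> [x|x U phi oU Ux phiC wphi].
  exact: (cvgD (wc x) (@cvg_cst _ (k : R^o) _ (nbhs x) _)).
by apply: wH phiC _ => //; apply: filterS wphi => y; rewrite !(addrAC _ k) lerD2r.
Qed.

Definition subsolution_levels H a : set R :=
  [set c | exists w, viscosity_subsolution A (frozen H a) c w].

Section ErgodicConstant.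
Context (H : M -> 'cV[R]_n -> R -> R) (hM : closed_connected M)
  (Hc : hamiltonian_continuous A H) (Hnd : hamiltonian_nondecreasing H)
  (Hco : forall a, locally_coercive (A := A) (fun x p => H x p a)).
Local Notation E := (subsolution_levels H).
Local Notation ec := (ergodic_constant A H).

Lemma levels_has_inf a : has_inf (E a).
Proof.
have [_ cM _ M0] := hM; have H0c := @hamiltonian0_continuous _ _ _ A H a Hc.
have [xM xMP] := compact_max cM M0 H0c; have [xm xmP] := compact_min cM M0 H0c.
split; first by exists (H xM 0 a), (fun=> 0); exact: subsolution_cst.
exists (H xm 0 a) => c [w wH]; have [wc _] := wH.
have [y yP] := compact_max cM M0 wc.
exact: le_trans (xmP y) (subsolution_test_cst wH yP).
Qed.

Lemma ergodic_le a c w : viscosity_subsolution A (frozen H a) c w -> ec a <= c.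
Proof. by move=> wH; apply: ge_inf; [have [] := levels_has_inf a|exists w]. Qed.

(** Up to level C, a subsolution for the parameter s is a subsolution for t
    at a level raised by e. *)
Lemma ergodic_le_of_levels (s t e : R) (C : R) :
  ec s < C -> (forall x p, H x p s <= C -> H x p t <= H x p s + e) ->
  ec t <= ec s + e.
Proof.
move=> sC st; apply/ler_addgt0Pr => d d0.
pose d' := Num.min d (C - ec s).
have d'0 : 0 < d' by rewrite lt_min d0 subr_gt0.
have [c [w wH] cs] := inf_adherent d'0 (levels_has_inf s).
have d'd : d' <= d by rewrite ge_min lexx.
have d'C : d' <= C - ec s by rewrite ge_min lexx orbT.
rewrite -/(ec s) in cs.
apply: (@le_trans _ _ (c + e)); last by lra.
apply: (@ergodic_le t _ w); apply: subsolution_le wH _ => x p; rewrite /frozen => h.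
have hC : H x p s <= C by apply: le_trans h _; lra.
by have := st x p hC; lra.
Qed.

Lemma ergodic_nondecreasing : {homo ec : a b / a <= b}.
Proof.
move=> a b ab; rewrite -[ec b]addr0.
apply: (@ergodic_le_of_levels b a 0 (ec b + 1)); first by rewrite ltrDl.
by move=> x p _; rewrite addr0; exact: Hnd.
Qed.

Lemma ergodic_continuous : continuous ec.
Proof.
move=> a; apply: (@cvg_nbhs_dist _ _ R^o) => e e0.
have e2 : 0 < e / 2 by rewrite divr_gt0.
have [_ cM _ _] := hM.
pose C := ec (a + 1) + 1.
have nu := hamiltonian_uniform_in_u a C cM Hc (Hco (a - 1)) e2.
have nb := @near_distC _ R^o a 1 ltr01.
apply: filterS2 nu nb => b hb; rewrite ltr_norml => /andP[b1 b2].
have low s : a - 1 <= s -> forall x p, H x p s <= C -> `|H x p b - H x p a| < e / 2.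
  by move=> as1 x p h; apply: hb; apply: le_trans h; exact: Hnd.
have top s : s <= a + 1 -> ec s < C.
  by move=> h; rewrite /C ltr_pwDr // ergodic_nondecreasing.
have h1 : ec b <= ec a + e / 2.
  apply: (@ergodic_le_of_levels a b _ C); first by apply: top; lra.
  move=> x p /low; rewrite lerBlDr lerDl => /(_ ler01).
  by rewrite ltr_norml => /andP[? ?]; lra.
have h2 : ec a <= ec b + e / 2.
  apply: (@ergodic_le_of_levels b a _ C); first by apply: top; lra.
  have ab : a - 1 <= b by lra.
  move=> x p /(low _ ab).
  by rewrite ltr_norml => /andP[? ?]; lra.
by rewrite ltr_norml; apply/andP; split; lra.
Qed.

(** The solution v of H(x, d_x v, a) + eps (v - a) = c(a) is close to the
    critical level once v - a is bounded, and the bound comes from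
    min v <= a, max v >= a - 1 and the uniform bound on oscillations. *)
Lemma discounted_solution a : exists K : R, forall eps : R, 0 < eps <= 1 ->
  exists v, [/\ viscosity_subsolution A (frozen H a) (ec a + eps * K) v,
    viscosity_supersolution A (frozen H a) (ec a - eps * K) v &
    forall x, `|v x - a| <= K].
Proof.
have [_ cM _ M0] := hM.
have [K1 K1P] := subsolutions_bounded_osc (ec a + 1) hM (Hco a).
have [K2 K2P] := subsolutions_bounded_osc (ec a + 1 + `|K1|) hM (Hco a).
exists (1 + `|K2|) => eps /andP[eps0 eps1].
set c := ec a.
pose G x p u := H x p a + eps * (u - a).
have [c1 [w wH] c1c] := inf_adherent eps0 (levels_has_inf a).
rewrite -/(ec a) -/c in c1c.
have [wc _] := wH; have [xM xMP] := compact_max cM M0 wc.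
(* w has level c1 < c + eps; on functions at most a - 1 the discount term is at
   most - eps, which absorbs the excess *)
pose w1 x := w x + (a - 1 - w xM).
have w1a x : w1 x <= a - 1 by rewrite /w1; have := xMP x; lra.
have w1F : viscosity_subsolution A (frozen H a) c1 w1 by exact: frozen_subsolution_shift.
have w1low x : a - 1 - `|K1| <= w1 x.
  have w1F' : viscosity_subsolution A (fun x p _ => H x p a) (ec a + 1) w1.
    by apply: subsolution_le w1F _ => y p; rewrite /frozen -/c => h; lra.
  have := K1P w1 w1F' xM x; have := ler_norm K1; rewrite /w1; lra.
have w1G : viscosity_subsolution A G c w1.
  apply: subsolution_le w1F _ => y p; rewrite /frozen /G => h.
  have : eps * (w1 y - a) <= eps * (- 1) by rewrite ler_pM2l //; have := w1a y; lra.
  by lra.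
have H0c := @hamiltonian0_continuous _ _ _ A H a Hc.
have [xm xmP] := compact_min cM M0 H0c.
(* a constant so large that the discount term makes it a supersolution *)
pose k := a + `|c - H xm 0 a| / eps.
have ka : a <= k by rewrite lerDl divr_ge0 // ltW.
have kG : viscosity_supersolution A G c (fun=> k).
  apply: supersolution_cst => x; rewrite /G /k addrAC subrr add0r.
  rewrite mulrC divfK ?gt_eqF //; have := xmP x; have := ler_norm (c - H xm 0 a); lra.
have Gc : hamiltonian_continuous A G.
  apply: (@frozen_addr_continuous H a (fun u => eps * (u - a))) => // u.
  apply: cvgMr; apply: cvgB; [exact: cvg_id|exact: cvg_cst].
have Gnd : hamiltonian_nondecreasing G.
  by move=> x p u v uv; rewrite /G lerD2l ler_pM2l // lerD2r.
have Gco b : locally_coercive (A := A) (fun x p => G x p b).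
  move=> C x0; have [r rP] := Hco a (C - eps * (b - a)) x0.
  by exists r; apply: filterS rP => x h q Gq; apply: h; rewrite /G in Gq; lra.
have [|v [[vsub vsup] w1v vk]] := perron hM Gc Gnd Gco w1G kG.
  by move=> x; apply: le_trans (w1a x) _; lra.
have [vc _] := vsub; have [ym ymP] := compact_min cM M0 vc.
have vF : viscosity_subsolution A (fun x p _ => H x p a) (ec a + 1 + `|K1|) v.
  apply: subsolution_le vsub _ => x p; rewrite /G -/c => h.
  have vlow : - (1 + `|K1|) <= v x - a by have := w1low x; have := w1v x; lra.
  have : eps * (- (1 + `|K1|)) <= eps * (v x - a) by rewrite ler_pM2l.
  have : eps * (1 + `|K1|) <= 1 + `|K1| by rewrite ler_piMl // addr_ge0.
  by rewrite mulrN; lra.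
have osc := K2P v vF; have K2n := ler_norm K2.
have vmin : v ym <= a.
  rewrite leNgt; apply/negP => av.
  have vstrict : viscosity_subsolution A (frozen H a) (c - eps * (v ym - a)) v.
    apply: subsolution_le vsub _ => x p; rewrite /G /frozen => h.
    have : eps * (v ym - a) <= eps * (v x - a) by rewrite ler_pM2l // lerD2r.
    by lra.
  have := ergodic_le vstrict; rewrite -/c.
  have : 0 < eps * (v ym - a) by rewrite mulr_gt0 // subr_gt0.
  by lra.
have vmax : a - 1 <= v xM by have := w1v xM; rewrite /w1; lra.
have vK x : `|v x - a| <= 1 + `|K2|.
  rewrite ler_norml; apply/andP; split.
    by have := osc xM x; lra.
  by have := osc x ym; lra.
have epsK x : `|eps * (v x - a)| <= eps * (1 + `|K2|).
  by rewrite normrM (ger0_norm (ltW eps0)) ler_pM2l.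
exists v; split=> //.
- apply: subsolution_le vsub _ => x p; rewrite /G /frozen -/c => h.
  by have := epsK x; rewrite ler_norml => /andP[? ?]; lra.
- apply: supersolution_le vsup _ => x p; rewrite /G /frozen -/c => h.
  by have := epsK x; rewrite ler_norml => /andP[? ?]; lra.
Qed.

(** A uniform limit point of the discounted solutions as eps tends to 0. *)
Lemma critical_solution a : exists v, viscosity_solution A (frozen H a) (ec a) v.
Proof.
have [_ cM _ M0] := hM.
have [K KP] := discounted_solution a.
have epsk (k : nat) : 0 < (k.+1%:R : R)^-1 <= 1.
  by rewrite invr_gt0 ltr0n /= invf_le1 // ler1n.
have /choice[v vP] := fun k => KP _ (epsk k).
have K0 : 0 <= K.
  have [x _] := M0; have [_ _ /(_ x)] := vP 0%N; exact: le_trans.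
have vF k : viscosity_subsolution A (fun x p _ => H x p a) (ec a + K) (v k).
  have [vsub _ _] := vP k; apply: subsolution_le vsub _ => x p h.
  by apply: le_trans h _; rewrite lerD2l ler_piMl //; case/andP: (epsk k).
have [||w wc wP] := @equicontinuous_subsequence_limit R M v (K + `|a|) cM.
- move=> x e e0.
  have := @subsolutions_equicontinuous _ _ _ _ _ (ec a + K) _ x (Hco a) e0.
  by apply: filterS => y yx k; exact: yx (vF k).
- move=> k x; have [_ _ vK] := vP k.
  by rewrite -[v k x](subrK a) (le_trans (ler_normD _ _)) // lerD2r.
have Fc := @frozen_continuous H a Hc.
have close d : 0 < d -> exists k, (k.+1%:R)^-1 * K <= d /\ forall x, `|v k x - w x| <= d.
  move=> d0; have [N NP] : exists N : nat, K / d < N%:R.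
    exists (Num.bound (K / d)); exact: archi_boundP (divr_ge0 K0 (ltW d0)).
  have [k kN kP] := wP d N d0; exists k; split=> //.
  rewrite ler_pdivrMl ?ltr0n //; rewrite ltr_pdivrMr // in NP; apply: le_trans (ltW NP) _.
  by rewrite ler_pM2r // ler_nat leqW.
exists w; split.
- apply: subsolution_stable => // x d d0; have [k [kd kw]] := close d d0.
  have [vsub _ _] := vP k; exists (v k); split.
  + apply: subsolution_le vsub _ => y p h; apply: le_trans h _; by rewrite lerD2l.
  + by move=> y; have := kw y; rewrite ler_norml => /andP[? ?]; lra.
  + by have := kw x; rewrite ler_norml => /andP[? ?]; lra.
- apply/supersolutionP; apply: subsolution_stable.
  + exact: dual_hamiltonian_continuous.
  + move=> x; exact: (cvgN (wc x)).
  move=> x d d0; have [k [kd kw]] := close d d0.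
  have [_ /supersolutionP vsup _] := vP k; exists (fun x => - v k x); split.
  + apply: subsolution_le vsup _ => y p h; apply: le_trans h _.
    by rewrite opprB addrC lerD2l.
  + by move=> y; have := kw y; rewrite ler_norml => /andP[? ?]; lra.
  + by have := kw x; rewrite ler_norml => /andP[? ?]; lra.
Qed.

(** Translating v to have maximum a makes it a subsolution of
    H(x, d_x u, u) = c(a), since H is non-decreasing in u; translating it to
    have minimum a makes it a supersolution. *)
Lemma ergodic_level_solution a : exists u, viscosity_solution A H (ec a) u.
Proof.
have [_ cM _ M0] := hM.
have [v [vsub vsup]] := critical_solution a; have [vc _] := vsub.
have [xM xMP] := compact_max cM M0 vc; have [xm xmP] := compact_min cM M0 vc.
pose w1 x := v x + (a - v xM); pose w2 x := v x + (a - v xm).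
have w1H : viscosity_subsolution A H (ec a) w1.
  apply: subsolution_le (frozen_subsolution_shift (a - v xM) vsub) _ => x p.
  by apply: le_trans; apply: Hnd; have := xMP x; lra.
have w2H : viscosity_supersolution A H (ec a) w2.
  apply: supersolution_le (frozen_supersolution_shift (a - v xm) vsup) _ => x p h.
  by apply: le_trans h _; apply: Hnd; have := xmP x; lra.
have [|u [uH _ _]] := perron hM Hc Hnd Hco w1H w2H; last by exists u.
by move=> x; rewrite /w1 /w2 lerD2l lerD2l lerN2.
Qed.

End ErgodicConstant.

End Ergodic.

Theorem proposition1p1 (R : realType) (n : nat) (M : topologicalType)
    (A : smooth_atlas R n M) (g : riemannian_metric A)
    (H : M -> 'cV[R]_n -> R -> R) :
  closed_connected M ->
  hamiltonian_continuous A H ->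
  hamiltonian_convex H ->
  hamiltonian_superlinear g H ->
  hamiltonian_nondecreasing H ->
  (continuous (ergodic_constant A H) /\
   {homo ergodic_constant A H : a b / a <= b}) /\
  (forall c : R, range (ergodic_constant A H) c ->
     exists u : M -> R, viscosity_solution A H c u).
Proof.
move=> hM Hc Hx Hs Hnd.
have Hco a := superlinear_locally_coercive a Hc Hx Hs.
split; first split.
- exact: ergodic_continuous.
- exact: ergodic_nondecreasing.
- by move=> _ [a _ <-]; exact: ergodic_level_solution.
Qed.
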